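(* Let $d \geq 2$ be a fixed integer, let $C \subset \mathbb{R}^d$ be a $d$-dimensional convex body, and let $\delta_T(C)$ and $\theta_T(C)$ denote its translative packing density and translative covering density. Then the following hold. (1a) Suppose that either $0 < \varepsilon \leq \frac{1}{d^{d+1}}$ (and $C$ is an arbitrary $d$-dimensional convex body), or $0 < \varepsilon < 1$ and $C$ is in addition centrally symmetric. If $\delta_T(C) > 1 - \varepsilon$, then $$\theta_T(C) < \left(1+\varepsilon^{\frac{1}{d+1}}\right)^{d+1}.$$ (1b) Suppose that $\frac{1}{d^{d+1}} < \varepsilon < 1$ and $C$ is not centrally symmetric. If $\delta_T(C) > 1 - \varepsilon$, then $$\theta_T(C) < \left(1+\varepsilon d^d\right)\left(1+\frac{1}{d}\right)^d.$$ (2) Suppose that $0 < \varepsilon < 1$ (and $C$ is an arbitrary $d$-dimensional convex body). If $\theta_T(C) < 1 + \varepsilon$, then $$\delta_T(C) > \left(1-\varepsilon^{\frac{1}{d+1}}\right)^{d+1}.$$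
   Context: A $d$-dimensional convex body $C$ in $\mathbb{R}^d$ is a compact convex set with nonempty interior. It is centrally symmetric if it is symmetric about some point, i.e. $C = v - C$ for some $v \in \mathbb{R}^d$. A (translative) arrangement is a set $C + A$, regarded as the family of translates $\{C + a : a \in A\}$, where $A$ is an infinite discrete point set in $\mathbb{R}^d$. The arrangement is called a packing if no two translates of $C$ in it (for distinct points of $A$) have an interior point in common. It is called a covering if $\mathbb{R}^d = C + A$, i.e. $\mathbb{R}^d = \bigcup_{a \in A} (C + a)$. Let $\mathrm{vol}$ denote $d$-dimensional volume (Lebesgue measure) and let $B^d(r)$ be the Euclidean ball of radius $r$ centered at the origin. The upper and lower densities of an arrangement are $$\overline{\mathrm{den}}(C+A) = \limsup_{r \to \infty} \frac{\sum_{a \in A}\mathrm{vol}\big((C+a)\cap B^d(r)\big)}{\mathrm{vol}(B^d(r))}, \qquad \underline{\mathrm{den}}(C+A) = \liminf_{r \to \infty} \frac{\sum_{a \in A}\mathrm{vol}\big((C+a)\cap B^d(r)\big)}{\mathrm{vol}(B^d(r))}.$$ The translative packing density of $C$ is $$\delta_T(C) = \sup\{\overline{\mathrm{den}}(C+A) : C+A \text{ is a packing}\},$$ and the translative covering density of $C$ is $$\theta_T(C) = \inf\{\underline{\mathrm{den}}(C+A) : C+A \text{ is a covering}\}.$$ *)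

(* Defs.v *)
From HB Require Import structures.
From mathcomp Require Import all_boot all_order all_algebra.
From mathcomp Require Import all_classical all_reals all_analysis.

Set Implicit Arguments.
Unset Strict Implicit.
Unset Printing Implicit Defensive.

Import Order.TTheory GRing.Theory Num.Theory.
Import numFieldNormedType.Exports.

Local Open Scope classical_set_scope.
Local Open Scope ring_scope.

(** The canonical topology of ['rV[R]_d] comes from the sup norm and is the usual
    topology of R^d; Euclidean balls are defined separately below. *)

Section Volume.
Context {R : realType} {d : nat}.
Implicit Types (a b : 'rV[R]_d) (X : set 'rV[R]_d).

Definition box a b : set 'rV[R]_d :=
  [set x | forall i, a ord0 i < x ord0 i <= b ord0 i].

Definition box_volume a b : R := \prod_i Num.max 0 (b ord0 i - a ord0 i).

(** d-dimensional Lebesgue outer measure. It agrees with Lebesgue measure on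
    measurable sets, and below it is only ever applied to compact sets. *)
Definition vol X : \bar R :=
  ereal_inf [set v : \bar R | exists a b : nat -> 'rV[R]_d,
    X `<=` \bigcup_k box (a k) (b k) /\
    v = (\sum_(0 <= k <oo) (box_volume (a k) (b k))%:E)%E].

Definition euclidean_ball (r : R) : set 'rV[R]_d :=
  [set x | Num.sqrt (\sum_i x ord0 i ^+ 2) <= r].

End Volume.

Section Arrangements.
Context {R : realType} {d : nat}.
Implicit Types (C A : set 'rV[R]_d).

Definition convex_body C :=
  [/\ compact C, convex_set (C : set (convex_lmodType 'rV[R]_d))
    & C° !=set0].

Definition centrally_symmetric C :=
  exists v : 'rV[R]_d, C = [set v - x | x in C].

Definition translate C (a : 'rV[R]_d) : set 'rV[R]_d := [set x + a | x in C].

(** The sets [A] for which [C + A] is an arrangement. *)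
Definition infinite_discrete A := infinite_set A /\ A `<=` isolated A.

Definition packing C A := infinite_discrete A /\
  forall a b, A a -> A b -> a <> b ->
    (translate C a)° `&` (translate C b)° = set0.

Definition covering C A := infinite_discrete A /\
  \bigcup_(a in A) translate C a = setT.

Definition density_in_ball C A (r : R) : \bar R :=
  ((\esum_(a in A) vol (translate C a `&` euclidean_ball r))
     / vol (@euclidean_ball R d r))%E.

Definition upper_density C A : \bar R :=
  limf_esup (density_in_ball C A) (pinfty_nbhs R).

Definition lower_density C A : \bar R :=
  limf_einf (density_in_ball C A) (pinfty_nbhs R).

Definition packing_density C : \bar R :=
  ereal_sup [set upper_density C A | A in packing C].

Definition covering_density C : \bar R :=
  ereal_inf [set lower_density C A | A in covering C].

End Arrangements.

(* Main.v *)
Require Import Defs.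
From HB Require Import structures.
From mathcomp Require Import all_boot all_order all_algebra.
From mathcomp Require Import all_classical all_reals all_analysis.
From mathcomp Require Import perm finmap ring lra.

Set Implicit Arguments.
Unset Strict Implicit.
Unset Printing Implicit Defensive.

Import Order.TTheory GRing.Theory Num.Theory.
Import numFieldNormedType.Exports.

Local Open Scope classical_set_scope.
Local Open Scope ring_scope.

(** Packing to covering: given a packing [C + A] of density above [1 - eps], choose a maximal set
    [X] of points such that the bodies [x - l C] ([x] in [X]) are disjoint from each other and
    from [C + A]. A point outside [(1 + l) C + A] lies in some [x + l (C - C)], hence in
    [x + t + (1 + l) C] as soon as [l k <= 1], where [- C] is contained in a translate of [k C];
    here [k = 1] if [C] is symmetric and [k = d] always works. So [(1 + l) C] covers space with
    the translations [A] and [X + t], and [X] has density at most [eps / (l ^ d vol C)] because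
    the bodies [x - l C] fit in the part not covered by [C + A]. Take [l = eps ^ (1 / (d + 1))]
    or [l = 1 / d] and rescale.

    Covering to packing: given a covering [C + A] of density below [1 + eps], choose a maximal
    [B] in [A] such that [(1 - l) C + B] is a packing. For each [a] in [A \ B] some copy
    [z a + l C] lies in both [C + a] and another translate [C + b], [b] in [B]; counting
    multiplicities, these copies have total density below [eps].

    Both estimates compare finitely many translates inside balls whose radii are arbitrarily
    large among those at which the given density bound holds, so no periodicity is needed.
    Riemann sums over a fine grid turn pointwise inequalities between sums of indicators of
    convex bodies into inequalities between volumes. *)

(** * Convex bodies and volume *)

Section Bodies.
Context {R : realType} {n : nat}.
Implicit Types (x y a : 'rV[R]_n) (C K X : set 'rV[R]_n) (e s t M : R).

Lemma coord_le_norm x i : `|x ord0 i| <= `|x|.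
Proof. by rewrite [leRHS]/Num.norm /= mx_normrE; apply/bigmax_geP; right; exists (ord0, i). Qed.

Lemma norm_le_coord x e : 0 <= e -> (forall i, `|x ord0 i| <= e) -> `|x| <= e.
Proof.
move=> e0 xe; rewrite [leLHS]/Num.norm /= mx_normrE.
by apply/bigmax_leP; split=> // -[i j] _ /=; rewrite (ord1 i).
Qed.

Lemma interior_normP K x :
  K° x <-> exists2 e, 0 < e & forall y, `|x - y| < e -> K y.
Proof.
rewrite /interior; split=> [/nbhs_ballP[e e0 xK]|[e e0 xK]].
  by exists e => // y xy; apply: xK; rewrite mx_norm_ball.
by apply/nbhs_ballP; exists e => // y; rewrite mx_norm_ball; exact: xK.
Qed.

Lemma convex_setP K : convex_set (K : set (convex_lmodType 'rV[R]_n)) <->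
  forall x y t, K x -> K y -> 0 <= t <= 1 -> K (t *: x + (1 - t) *: y).
Proof.
split=> [cK x y t Kx Ky t01|cK x y l].
  by have /set_mem := cK x y (Itv01 (andP t01).1 (andP t01).2) (mem_set Kx) (mem_set Ky).
move=> /set_mem Kx /set_mem Ky; apply/mem_set/cK => //.
by apply/andP; split; [exact: ge0|exact: le1].
Qed.

Lemma compact_norm_bound K : compact K -> exists2 M, 0 < M & forall x, K x -> `|x| <= M.
Proof.
move=> /compact_bounded[M [_ KM]]; exists (`|M| + 1); first exact: ltr_pwDr.
by move=> x Kx; apply: KM => //; rewrite (le_lt_trans (ler_norm _))// ltrDl.
Qed.

Definition homothet s a K : set 'rV[R]_n := [set a + s *: x | x in K].

Lemma homothetE s a K x : s != 0 -> homothet s a K x <-> K (s^-1 *: (x - a)).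
Proof.
move=> s0; split=> [[y Ky <-]|Kx].
  by rewrite addrAC subrr add0r scalerA mulVf// scale1r.
by exists (s^-1 *: (x - a)) => //; rewrite scalerA divff// scale1r addrC subrK.
Qed.

Lemma homothet_translate a K : translate K a = homothet 1 a K.
Proof. by apply/seteqP; split=> _ [x Kx <-]; exists x; rewrite // scale1r addrC. Qed.

Lemma homothet_comp s a t b K :
  homothet s a (homothet t b K) = homothet (s * t) (a + s *: b) K.
Proof.
apply/seteqP; split=> [_ [_ [x Kx <-] <-]|_ [x Kx <-]].
  by exists x => //; rewrite scalerDr addrA scalerA.
by exists (b + t *: x); [exists x|rewrite scalerDr addrA scalerA].
Qed.

Lemma homothet_compact s a K : compact K -> compact (homothet s a K).
Proof.
move=> cK; rewrite /homothet; refine (@continuous_compact _ _ (fun x => a + s *: x) K _ cK).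
apply: continuous_subspaceT => x; apply: (@continuousD _ _ _ (fun=> a) (fun x => s *: x)).
  exact: cst_continuous.
exact: scaler_continuous.
Qed.

Lemma homothet_interior s a K x : s != 0 -> K° x -> (homothet s a K)° (a + s *: x).
Proof.
move=> s0 /interior_normP[e e0 xK]; apply/interior_normP.
exists (`|s| * e) => [|y xy]; first by rewrite mulr_gt0 ?normr_gt0.
apply/homothetE => //; apply: xK.
rewrite -(ltr_pM2l (_ : 0 < `|s|)) ?normr_gt0// -normrZ scalerBr scalerA divff// scale1r.
by rewrite opprB addrA [s *: x + a]addrC.
Qed.

Lemma homothet_convex_body s a K : s != 0 -> convex_body K -> convex_body (homothet s a K).
Proof.
move=> s0 [cK /convex_setP xK [x0 Kx0]]; split; first exact: homothet_compact.
  apply/convex_setP => _ _ t [x Kx <-] [y Ky <-] t01.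
  exists (t *: x + (1 - t) *: y); first exact: xK.
  rewrite !scalerDr !scalerA ![_ * s]mulrC.
  rewrite scalerBl scale1r addrACA [t *: a + _]addrC subrK.
  by [].
by exists (a + s *: x0); exact: homothet_interior.
Qed.

Lemma translate_convex_body a K : convex_body K -> convex_body (translate K a).
Proof. by rewrite homothet_translate; apply: homothet_convex_body; rewrite oner_eq0. Qed.

(** The displacement from the shrunk copy is charged to [c]: since [c] carries the weight [t], it
    moves by less than [e]. *)
Lemma convex_shrink K c e t x y :
  convex_set (K : set (convex_lmodType 'rV[R]_n)) ->
  (forall z, `|c - z| < e -> K z) -> 0 < t < 1 ->
  homothet (1 - t) (t *: c) K x -> `|x - y| < t * e -> K y.
Proof.
move=> /convex_setP cK ceK /andP[t0 t1] [z Kz <-] zy.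
have -> : y = (1 - t) *: z + (1 - (1 - t)) *: (c - t^-1 *: (t *: c + (1 - t) *: z - y)).
  by apply/rowP => i; rewrite !mxE; field; rewrite gt_eqF.
apply: cK => //; last by rewrite subr_ge0 ltW//= gerBl ltW.
apply: ceK; rewrite subKr normrZ gtr0_norm ?invr_gt0//.
by rewrite mulrC ltr_pdivrMr// mulrC.
Qed.

End Bodies.

(** * Outer volume: box covers and scaling *)

Section Volume.
Context {R : realType} {n : nat}.
Implicit Types (x y a b : 'rV[R]_n.+1) (X Y : set 'rV[R]_n.+1) (s : R).

Lemma box_volume_ge0 a b : 0 <= box_volume a b.
Proof. by apply: prodr_ge0 => i _; rewrite le_max lexx. Qed.

Lemma vol_ge0 X : (0 <= vol X)%E.
Proof.
apply: le_ereal_inf_tmp => _ [a [b [_ ->]]].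
by apply: nneseries_ge0 => k _ _; rewrite lee_fin box_volume_ge0.
Qed.

Lemma vol_mono X Y : X `<=` Y -> (vol X <= vol Y)%E.
Proof.
move=> XY; apply: ereal_inf_le_tmp => _ [a [b [Yab ->]]].
by exists a, b; split=> //; exact: subset_trans Yab.
Qed.

Lemma vol_le_boxes X (s : seq ('rV[R]_n.+1 * 'rV[R]_n.+1)) :
  (forall x, X x -> exists2 p, p \in s & box p.1 p.2 x) ->
  (vol X <= (\sum_(p <- s) box_volume p.1 p.2)%:E)%E.
Proof.
move=> Xs; apply: ge_ereal_inf.
exists (\sum_(0 <= k <oo) (box_volume (nth (0, 0) s k).1 (nth (0, 0) s k).2)%:E)%E.
  exists (fun k => (nth (0, 0) s k).1), (fun k => (nth (0, 0) s k).2); split=> //.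
  move=> x /Xs[p ps px]; exists (index p s) => //=.
  by rewrite nth_index.
(* The list is continued by the default box from [0] to [0], whose volume is 0 because the dimension
   is positive. *)
rewrite (nneseries_split 0 (size s)); last by move=> k _; rewrite lee_fin box_volume_ge0.
rewrite [X in (_ + X)%E]eseries0 ?adde0; last first.
  move=> k /=; rewrite add0n => sk _; rewrite nth_default//=; congr EFin.
  by rewrite /box_volume (bigD1 ord0)//= mxE subrr maxxx mul0r.
by rewrite add0n (big_nth (0, 0)) sumEFin.
Qed.

Lemma vol_lty X (M : R) : (forall x, X x -> `|x| <= M) -> (vol X < +oo)%E.
Proof.
move=> XM; apply: (@le_lt_trans _ _ (\sum_(p <- [:: (const_mx (- (M + 1)), const_mx (M + 1))])
    box_volume p.1 p.2)%:E)%E; last by rewrite ltry.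
apply: vol_le_boxes => x /XM xM; eexists; first by rewrite inE.
move=> i /=; rewrite !mxE; have := le_trans (coord_le_norm x i) xM.
by rewrite ler_norml => /andP[Mx xM']; lra.
Qed.

Lemma vol_fin X (M : R) : (forall x, X x -> `|x| <= M) -> vol X \is a fin_num.
Proof. by move=> XM; rewrite ge0_fin_numE ?vol_ge0 ?(vol_lty XM). Qed.

Lemma vol_set0 : vol (@set0 'rV[R]_n.+1) = 0%E.
Proof.
apply/eqP; rewrite eq_le vol_ge0 andbT.
by rewrite (le_trans (vol_le_boxes (s := [::]) _))// big_nil.
Qed.

Lemma box_volume_homothet s a b c : 0 < s ->
  box_volume (c + s *: a) (c + s *: b) = s ^+ n.+1 * box_volume a b.
Proof.
move=> s0; rewrite /box_volume -[X in s ^+ X]card_ord -prodr_const -big_split/=.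
apply: eq_bigr => i _; rewrite !mxE maxr_pMr ?ltW// mulr0.
by congr Num.max; ring.
Qed.

Lemma vol_homothet_le s a X : 0 < s ->
  (vol (homothet s a X) <= (s ^+ n.+1)%:E * vol X)%E.
Proof.
move=> s0; rewrite -lee_pdivrMl ?exprn_gt0//.
apply: le_ereal_inf_tmp => _ [b [c [Xbc ->]]].
rewrite lee_pdivrMl ?exprn_gt0// -nneseriesZl; last first.
  by move=> k _; rewrite lee_fin box_volume_ge0.
apply: ereal_inf_lbound; exists (fun k => a + s *: b k), (fun k => a + s *: c k); split.
  move=> _ [x /Xbc[k _ bcx] <-]; exists k => // i; rewrite !mxE.
  by rewrite ltrD2l lerD2l ltr_pM2l// ler_pM2l.
by apply: eq_eseriesr => k _; rewrite box_volume_homothet// EFinM.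
Qed.

Lemma homothetK s a X : s != 0 -> homothet s^-1 (- s^-1 *: a) (homothet s a X) = X.
Proof.
move=> s0; rewrite homothet_comp mulVf// scaleNr addNr.
apply/seteqP; split=> [_ [x Xx <-]|x Xx]; first by rewrite scale1r add0r.
by exists x; rewrite // scale1r add0r.
Qed.

Lemma vol_homothet s a X : 0 < s -> vol (homothet s a X) = ((s ^+ n.+1)%:E * vol X)%E.
Proof.
move=> s0; apply/eqP; rewrite eq_le vol_homothet_le//=.
rewrite -lee_pdivlMl ?exprn_gt0//.
rewrite -{1}(@homothetK s a X) ?gt_eqF//.
by rewrite -exprVn vol_homothet_le// invr_gt0.
Qed.

End Volume.

(** * Midpoint Riemann sums on a cubic grid *)

Section Grid.
Context {R : realType} {n : nat}.
Implicit Types (x y a b : 'rV[R]_n.+1) (K : set 'rV[R]_n.+1) (f g : 'rV[R]_n.+1 -> R).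

Definition mesh N : R := N.+1%:R^-1.

Definition node L N (k : nat) : R := mesh N * (k%:R + 2^-1) - L%:R.

Definition grid_point L N (k : {ffun 'I_n.+1 -> 'I_(2 * L * N.+1)}) : 'rV[R]_n.+1 :=
  \row_i node L N (k i).

(* Midpoint Riemann sum over the cube [[-L, L]^(n+1)]; the grid is symmetric about [0]. *)
Definition grid_sum L N f : R := \sum_k mesh N ^+ n.+1 * f (@grid_point L N k).

Lemma mesh_gt0 N : 0 < mesh N.
Proof. by rewrite invr_gt0 ltr0n. Qed.

Lemma mesh_small (e : R) : 0 < e -> \forall N \near \oo, mesh N < e.
Proof.
by move=> e0; near=> N; near: N; exact: near_infty_natSinv_lt (PosNum e0).
Unshelve. all: by end_near. Qed.

Lemma le_grid_sum L N f g : (forall x, f x <= g x) -> grid_sum L N f <= grid_sum L N g.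
Proof.
move=> fg; apply: ler_sum => k _; apply: ler_wpM2l => //.
by rewrite exprn_ge0// ltW ?mesh_gt0.
Qed.

Lemma grid_sum_sum L N (I : finType) (F : I -> 'rV[R]_n.+1 -> R) :
  grid_sum L N (fun x => \sum_i F i x) = \sum_i grid_sum L N (F i).
Proof. by rewrite /grid_sum exchange_big/=; apply: eq_bigr => k _; rewrite mulr_sumr. Qed.

(** Reversing every index negates the grid point. This will give the reflection invariance of
    volume, as half-open boxes are not preserved by negation. *)
Lemma grid_sumN L N f : grid_sum L N (fun x => f (- x)) = grid_sum L N f.
Proof.
pose r (k : {ffun 'I_n.+1 -> 'I_(2 * L * N.+1)}) := [ffun i => rev_ord (k i)].
have rK : involutive r by move=> k; apply/ffunP => i; rewrite !ffunE rev_ordK.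
rewrite /grid_sum [RHS](reindex_inj (inv_inj rK)).
apply: eq_bigr => k _; congr (_ * f _); apply/rowP => i; rewrite !mxE !ffunE /node/=.
rewrite natrB ?ltn_ord// !natrM -[(k i).+1]addn1 natrD /mesh.
by field; rewrite addrC natr1 pnatr_eq0.
Qed.

Lemma node_count L N m (a b : R) :
  \sum_(k < m) mesh N * (a < node L N k <= b)%R%:R <= Num.max 0 (b - a) + mesh N.
Proof.
have h0 := mesh_gt0 N.
have [ab|ba] := leP a b; last first.
  rewrite big1 ?addr_ge0 ?(ltW h0)// ?le_max ?lexx// => k _.
  have [/andP[ak kb]|] := boolP (a < _ <= b); last by rewrite mulr0.
  by have := lt_le_trans ak kb; rewrite ltNge ltW.
(* [phi] clamps to the interval from [a] to [b + mesh N]. It gains a full mesh at each counted node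
   and never decreases, so the count telescopes. *)
pose phi (x : R) := Num.max a (Num.min x (b + mesh N)).
have phiS (k : nat) : mesh N * (a < node L N k <= b)%R%:R <= phi (node L N k.+1) - phi (node L N k).
  have -> : node L N k.+1 = node L N k + mesh N by rewrite /node -natr1; ring.
  set q := node L N k; rewrite /phi.
  have [/andP[aq qb]|_] := boolP (a < q <= b).
    have -> : Num.min (q + mesh N) (b + mesh N) = q + mesh N by rewrite min_l ?lerD2r.
    have -> : Num.min q (b + mesh N) = q by rewrite min_l//; lra.
    by rewrite mulr1 !max_r; lra.
  rewrite mulr0 subr_ge0 le_max2//.
  by rewrite le_min2// lerDl ltW.
apply: le_trans (_ : phi (node L N m) - phi (node L N 0) <= _); last first.
  rewrite max_r ?subr_ge0// /phi.
  have : a <= Num.max a (Num.min (node L N 0) (b + mesh N)) by rewrite le_max lexx.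
  have : Num.max a (Num.min (node L N m) (b + mesh N)) <= b + mesh N.
    by rewrite ge_max ge_min lexx orbT andbT; lra.
  lra.
rewrite -(telescope_sumr (fun k => phi (node L N k)))// big_mkord.
by apply: ler_sum => k _.
Qed.

(** The indicator of a box is a product over coordinates, so the sum over index functions
    distributes into a product of one-dimensional counts. *)
Lemma grid_sum_box L N a b :
  grid_sum L N \1_(box a b) <= \prod_i (Num.max 0 (b ord0 i - a ord0 i) + mesh N).
Proof.
have E (k : {ffun 'I_n.+1 -> 'I_(2 * L * N.+1)}) :
    mesh N ^+ n.+1 * \1_(box a b) (grid_point k) =
    \prod_i (mesh N * (a ord0 i < node L N (k i) <= b ord0 i)%R%:R).
  rewrite big_split/= prodr_const card_ord indicE; congr (_ * _).
  have [kab|kab] := pselect (box a b (grid_point k)).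
    by rewrite mem_set// big1// => i _; have := kab i; rewrite mxE => ->.
  rewrite memNset//; apply/esym/eqP; rewrite prodf_seq_eq0; apply/hasP.
  have /existsNP[i iab] := kab; exists i; first by rewrite mem_index_enum.
  by move: iab; rewrite mxE /= => /negP/negbTE ->.
rewrite /grid_sum (eq_bigr _ (fun k _ => E k)).
rewrite -(bigA_distr_bigA (fun i (j : 'I__) => mesh N * (a ord0 i < node L N j <= b ord0 i)%R%:R)).
apply: ler_prod => i _; rewrite node_count andbT.
by apply: sumr_ge0 => j _; rewrite mulr_ge0// ltW ?mesh_gt0.
Qed.

Lemma node_cell L N (x : R) : `|x| < L%:R ->
  exists k : 'I_(2 * L * N.+1), node L N k - mesh N / 2 < x <= node L N k + mesh N / 2.
Proof.
rewrite ltr_norml => /andP[Lx xL]; have h0 := mesh_gt0 N.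
have hN : mesh N * N.+1%:R = 1 by rewrite mulVf// pnatr_eq0.
pose y := (x + L%:R) * N.+1%:R.
have y0 : 0 < y by rewrite mulr_gt0 ?ltr0n//; lra.
have := ceil_itv y; have : 0 < Num.ceil y by rewrite ceil_gt0.
(* Cells are open on the left, so the cell of [x] has index one less than the ceiling of [y]. *)
case: (Num.ceil y) => // -[//|j] _; rewrite intS addrAC subrr add0r -!pmulrn => /andP[jy yj].
have jm : (j < 2 * L * N.+1)%N.
  rewrite -(ltr_nat R) (lt_le_trans jy)// !natrM ler_wpM2r ?ler0n//; lra.
exists (Ordinal jm); rewrite /node/=.
have xE : x = mesh N * y - L%:R.
  by rewrite /y mulrCA hN mulr1 addrK.
have jy2 : mesh N * j%:R < mesh N * y by rewrite ltr_pM2l.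
have yj' : mesh N * y <= mesh N * (1 + j%:R) by rewrite ler_pM2l // -(natrD _ 1 j).
rewrite xE; apply/andP; split; lra.
Qed.

Lemma grid_cell L N x : `|x| < L%:R ->
  exists2 k, box (@grid_point L N k - const_mx (mesh N / 2))
                 (@grid_point L N k + const_mx (mesh N / 2)) x
    & `|x - @grid_point L N k| <= mesh N / 2.
Proof.
move=> xL; have /choice[k kP] : forall i, exists k : 'I_(2 * L * N.+1),
    node L N k - mesh N / 2 < x ord0 i <= node L N k + mesh N / 2.
  by move=> i; apply: node_cell; rewrite (le_lt_trans _ xL)// coord_le_norm.
exists [ffun i => k i] => [i|]; first by rewrite !mxE ffunE.
apply: norm_le_coord => [|i]; first by rewrite divr_ge0// ltW ?mesh_gt0.
rewrite !mxE ffunE ler_norml; have /andP[] := kP i; lra.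
Qed.

End Grid.

(** * Grid sums compared with volume *)

Section GridVolume.
Context {R : realType} {n : nat}.
Implicit Types (x y a b : 'rV[R]_n.+1) (K : set 'rV[R]_n.+1).

(* The mesh cells centred at the grid points of the interior of [K] cover [K] shrunk by
   [1 - t] towards [c]. *)
Lemma grid_sum_ge_vol L N K c e t :
  convex_set (K : set (convex_lmodType 'rV[R]_n.+1)) ->
  (forall z, `|c - z| < e -> K z) -> 0 < t < 1 -> mesh N < t * e ->
  (forall x, K x -> `|x| < L%:R) ->
  (((1 - t) ^+ n.+1)%:E * vol K <= (grid_sum L N \1_(K°))%:E)%E.
Proof.
move=> cK ceK t01 Nte KL; have h0 := @mesh_gt0 R N.
have /andP[t0 t1] := t01.
rewrite -(vol_homothet (t *: c)) ?subr_gt0//.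
pose s : seq ('rV[R]_n.+1 * 'rV[R]_n.+1) := 
  [seq (grid_point k - const_mx (mesh N / 2), grid_point k + const_mx (mesh N / 2)) |
   k <- enum [pred k : {ffun 'I_n.+1 -> 'I_(2 * L * N.+1)} |
     grid_point k \in (K° : set 'rV[R]_n.+1)]].
apply: (@le_trans _ _ (\sum_(p <- s) box_volume p.1 p.2)%:E).
  apply: vol_le_boxes => x xK.
  have Kx : K x.
    by apply: (convex_shrink cK ceK t01 xK); rewrite subrr normr0 (lt_trans h0).
  have [k xk xk'] := grid_cell N (KL _ Kx).
  exists (grid_point k - const_mx (mesh N / 2), grid_point k + const_mx (mesh N / 2)) => //.
  apply/mapP; exists k => //; rewrite mem_enum unfold_in /=; apply/mem_set/interior_normP.
  exists (mesh N / 2); first by rewrite divr_gt0.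
  move=> y ky; apply: (convex_shrink cK ceK t01 xK).
  rewrite -(subrKA (grid_point k)) (le_lt_trans (ler_normD _ _))//; lra.
rewrite lee_fin big_map big_enum_cond/= big_mkcond/= /grid_sum.
apply: ler_sum => k _; rewrite indicE inE andbT.
case: ifPn => [kK|_]; last by rewrite mulr0.
rewrite mulr1 /box_volume.
rewrite -[X in _ <= _ ^+ X]card_ord -prodr_const le_eqVlt; apply/orP; left; apply/eqP.
by apply: eq_bigr => i _; rewrite !mxE max_r; lra.
Qed.

Lemma box_volume_enlarge a b (e : R) : 0 < e -> exists2 t, 0 < t &
  \prod_i (Num.max 0 (b ord0 i - a ord0 i) + 2 * t) <= box_volume a b + e.
Proof.
move=> e0.
pose p : {poly R} := \prod_i ((Num.max 0 (b ord0 i - a ord0 i))%:P + 2%:P * 'X).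
have pE t : \prod_i (Num.max 0 (b ord0 i - a ord0 i) + 2 * t) = p.[t].
  by rewrite horner_prod; apply: eq_bigr => i _; rewrite !hornerE.
have p0 : p.[0] = box_volume a b.
  by rewrite -pE /box_volume; apply: eq_bigr => i _; rewrite mulr0 addr0.
have /(_ _ (p.[0] + e)) := @cvgr_lt _ _ _ _ _ _ (@continuous_horner R p 0).
rewrite ltrDl => /(_ e0) /nbhs_normP[r /= r0 rp].
exists (r / 2); first by rewrite divr_gt0.
rewrite pE -p0 ltW//; apply: rp => /=.
by rewrite sub0r normrN gtr0_norm ?divr_gt0// ltr_pdivrMr//; lra.
Qed.

(** By compactness, finitely many slightly enlarged boxes of a nearly optimal cover suffice;
    [grid_sum_box] applies to them once the mesh is below every enlargement. *)
Lemma grid_sum_le_vol L K (e : R) : compact K -> 0 < e ->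
  \forall N \near \oo, grid_sum L N \1_K <= fine (vol K) + e.
Proof.
move=> cK e0.
have [M _ KM] := compact_norm_bound cK; have Kfin := vol_fin KM.
have : (vol K < (fine (vol K) + e / 2)%:E)%E.
  by rewrite -{1}(fineK Kfin) lte_fin ltrDl divr_gt0.
move=> /ereal_inf_lt[_ [a [b [Kab ->]]] abK].
(* Half of [e] is spent on the cover, half as a geometric series on the enlargements. Of [2 * t],
   one [t] makes the interiors of the boxes cover [K] and the other absorbs the mesh. *)
have /choice[t tP] : forall k, exists t, 0 < t /\
    \prod_i (Num.max 0 (b k ord0 i - a k ord0 i) + 2 * t) <=
    box_volume (a k) (b k) + e / 2 / (2 ^ k.+1)%:R.
  move=> k; have /(box_volume_enlarge (a k) (b k))[t t0 tP] : 0 < e / 2 / (2 ^ k.+1)%:R.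
    by rewrite !divr_gt0// ltr0n expn_gt0.
  by exists t.
pose O k := (box (a k) (b k + const_mx (t k)))°.
move: (cK); rewrite compact_cover => /(_ nat setT O)[k _|x Kx|D _ KD].
- exact: open_interior.
- have [k _ xk] := Kab _ Kx; exists k => //; apply/interior_normP.
  have [tk _] := tP k.
  exists (\big[Num.min/t k]_i (x ord0 i - a k ord0 i)).
    by apply/bigmin_gtP; split=> // i _; rewrite subr_gt0; have /andP[] := xk i.
  move=> y /bigmin_gtP[xyt xya] i; rewrite !mxE.
  have := coord_le_norm (x - y) i; rewrite !mxE ler_norml => /andP[xy1 xy2].
  have /andP[_ xb] := xk i; have := xya i isT => xyi.
  by apply/andP; split; lra.
pose m := (\max_(k <- D) k).+1.
have Km x : K x -> exists k : 'I_m, box (a k) (b k + const_mx (t k)) x.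
  move=> /KD[k kD kx]; have km : (k < m)%N by rewrite ltnS leq_bigmax_seq.
  by exists (Ordinal km); exact: interior_subset kx.
have : \forall N \near \oo, forall k : 'I_m, mesh N < t k.
  by apply: filter_forall => k; apply: mesh_small; have [] := tP k.
apply: filterS => N Nt.
apply: le_trans (_ : grid_sum L N (fun x =>
    \sum_(k < m) \1_(box (a k) (b k + const_mx (t k))) x) <= _).
  apply: le_grid_sum => x; rewrite indicE.
  have [Kx|Kx] := pselect (K x); last by rewrite memNset// sumr_ge0.
  have [k kx] := Km _ Kx.
  by rewrite (bigD1 k)//= indicE !mem_set// lerDl sumr_ge0.
rewrite (grid_sum_sum L N (fun (k : 'I_m) => \1_(box (a k) (b k + const_mx (t k))))).
apply: le_trans (_ : \sum_(k < m) (box_volume (a k) (b k) + e / 2 / (2 ^ k.+1)%:R) <= _).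
  apply: ler_sum => k _; have [tk0 tk] := tP k.
  apply: le_trans (grid_sum_box _ _ _ _) (le_trans _ tk).
  apply: ler_prod => i _; rewrite addr_ge0 ?le_max ?lexx//=; last by rewrite ltW ?mesh_gt0.
  rewrite !mxE; apply: le_trans (_ : Num.max 0 (b k ord0 i - a k ord0 i) + t k + mesh N <= _).
    rewrite lerD2r ge_max addr_ge0 ?le_max ?lexx ?(ltW tk0)//=.
    have : b k ord0 i - a k ord0 i <= Num.max 0 (b k ord0 i - a k ord0 i).
      by rewrite le_max lexx orbT.
    lra.
  by have := Nt k; lra.
rewrite -lee_fin; apply: (@le_trans _ _
  (\sum_(0 <= k <oo) ((box_volume (a k) (b k))%:E + (e / 2 / (2 ^ k.+1)%:R)%:E))%E).
  rewrite -sumEFin.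
  rewrite -(big_mkord xpredT (fun k => (box_volume (a k) (b k) + e / 2 / (2 ^ k.+1)%:R)%:E)).
  apply: nneseries_lim_ge => k _ _.
  by rewrite lee_fin addr_ge0 ?box_volume_ge0// !divr_ge0// ltW.
apply: le_trans (epsilon_trick _ _ _) _ => [k||].
- by rewrite lee_fin box_volume_ge0.
- by rewrite divr_ge0 ?ltW.
have -> : fine (vol K) + e = fine (vol K) + e / 2 + e / 2 by lra.
by rewrite [X in (_ <= X)%E]EFinD leeD2r// ltW.
Qed.

End GridVolume.

(** * Volume inequalities for families of bodies *)

Section ConvexVolume.
Context {R : realType} {n : nat}.
Implicit Types (x y a b : 'rV[R]_n.+1) (K : set 'rV[R]_n.+1).

Definition fvol K : R := fine (vol K).

Lemma fvol_ge0 K : 0 <= fvol K.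
Proof. by rewrite fine_ge0// vol_ge0. Qed.

Lemma compact_volE K : compact K -> vol K = (fvol K)%:E.
Proof. by move=> /compact_norm_bound[M _ KM]; rewrite /fvol fineK// (vol_fin KM). Qed.

Lemma convex_body_volE K : convex_body K -> vol K = (fvol K)%:E.
Proof. by case=> cK _ _; exact: compact_volE. Qed.

Lemma bernoulli_le (t : R) m : 0 <= t <= 1 -> 1 - m%:R * t <= (1 - t) ^+ m.
Proof.
move=> /andP[t0 t1]; elim: m => [|m IH]; first by rewrite mul0r subr0 expr0.
rewrite exprS -natr1.
have m0 : 0 <= m%:R :> R by [].
nra.
Qed.

Lemma ler_of_shrink m (A B : R) :
  (forall t, 0 < t < 1 -> (1 - t) ^+ m * A <= B) -> 0 <= A -> A <= B.
Proof.
move=> AB A0; apply/ler_addgt0Pr => e e0.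
have m0 : 0 <= m%:R :> R by [].
(* By Bernoulli the loss is at most [m t A], which this [t] keeps below [e]; the other terms of the
   denominator secure [0 < t < 1]. *)
pose t := e / (e + m%:R * A + 1 + e).
have mA0 : 0 <= m%:R * A by rewrite mulr_ge0.
have den0 : 0 < e + m%:R * A + 1 + e by lra.
have t01 : 0 < t < 1 by rewrite divr_gt0//= ltr_pdivrMr//; lra.
have := AB t t01; have /andP[t0 t1] := t01.
have b1 : 1 - m%:R * t <= (1 - t) ^+ m by rewrite bernoulli_le // !ltW.
have tE : t * (e + m%:R * A + 1 + e) = e by rewrite divfK// gt_eqF//.
nra.
Qed.

(** Grid sums bound the left volumes from below, up to a factor tending to 1, and the right ones
    from above, up to an error tending to 0. The hypothesis concerns grids only, which leaves room
    for the symmetry of the grid in [fvol_le_opp]. *)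
Lemma volume_le_grid (I J : finType) (K : I -> set 'rV[R]_n.+1) (K' : J -> set 'rV[R]_n.+1) :
  (forall i, convex_body (K i)) -> (forall j, compact (K' j)) ->
  (forall L N, \sum_i grid_sum L N \1_((K i)°) <= \sum_j grid_sum L N \1_(K' j)) ->
  \sum_i fvol (K i) <= \sum_j fvol (K' j).
Proof.
move=> bK cK' KK'.
have /choice[M KM] : forall i, exists M, forall x, K i x -> `|x| <= M.
  by move=> i; have [/compact_norm_bound[M _ KM] _ _] := bK i; exists M.
have /choice[c cP] : forall i, exists c, exists e, 0 < e /\ forall z, `|c - z| < e -> K i z.
  move=> i; have [_ _ [c /interior_normP[e e0 ce]]] := bK i.
  by exists c, e.
have /choice[e eP] := cP.
have LM : \forall L \near \oo, forall i, M i < L%:R.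
  by apply: filter_forall => i; exact: nbhs_infty_gtr.
have [L {}LM] := filter_ex LM.
apply: (@ler_of_shrink n.+1); last by apply: sumr_ge0 => i _; exact: fvol_ge0.
move=> t t01; apply/ler_addgt0Pr => d d0.
(* One error [eta] for each [j] adds up to at most [d]; the [+ 1] covers an empty [J]. *)
pose eta := d / (#|J|%:R + 1).
have eta0 : 0 < eta by rewrite divr_gt0// ltr_wpDl.
have N1 : \forall N \near \oo, forall i, mesh N < t * e i.
  apply: filter_forall => i; apply: mesh_small.
  by have [e0 _] := eP i; have /andP[t0 _] := t01; rewrite mulr_gt0.
have N2 : \forall N \near \oo, forall j, grid_sum L N \1_(K' j) <= fvol (K' j) + eta.
  by apply: filter_forall => j; exact: grid_sum_le_vol.
have [N [{}N1 {}N2]] := filter_ex (filterI N1 N2).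
rewrite mulr_sumr; apply: le_trans (_ : \sum_i grid_sum L N \1_((K i)°) <= _).
  apply: ler_sum => i _; rewrite -lee_fin EFinM -convex_body_volE//.
  have [_ ce] := eP i; have [_ vK _] := bK i.
  apply: (grid_sum_ge_vol vK ce t01 (N1 i)) => x Kx.
  by rewrite (le_lt_trans (KM _ _ Kx)).
apply: le_trans (KK' L N) _.
apply: le_trans (ler_sum _ (fun j _ => N2 j)) _.
rewrite big_split/= lerD2l sumr_const -mulr_natr /eta mulrAC ler_pdivrMr ?ltr_wpDl//.
by rewrite ler_wpM2l ?lerDl// ltW.
Qed.

(** This takes the place of integrating sums of indicators. Interiors on the left and compact sets
    on the right make shared boundaries harmless. *)
Lemma volume_le (I J : finType) (K : I -> set 'rV[R]_n.+1) (K' : J -> set 'rV[R]_n.+1) :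
  (forall i, convex_body (K i)) -> (forall j, compact (K' j)) ->
  (forall x, \sum_i \1_((K i)°) x <= \sum_j \1_(K' j) x :> R) ->
  \sum_i fvol (K i) <= \sum_j fvol (K' j).
Proof.
move=> bK cK' KK'; apply: volume_le_grid => // L N.
by rewrite -!grid_sum_sum; exact: le_grid_sum.
Qed.

Lemma fvol_le_opp K : convex_body K -> fvol K <= fvol (homothet (-1) 0 K).
Proof.
move=> bK.
have := @volume_le_grid unit unit (fun=> K) (fun=> homothet (-1) 0 K).
rewrite !big_const !iter_addr_0 card_unit !mulr1n; apply=> [//|_|L N].
  by apply: homothet_compact; have [] := bK.
rewrite !big_const !iter_addr_0 card_unit !mulr1n -[leRHS]grid_sumN.
apply: le_grid_sum => x; rewrite !indicE ler_nat.
have [Kx|Kx] := pselect (K° x); last by rewrite memNset.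
rewrite !mem_set//; exists x; first exact: interior_subset.
by rewrite scaleN1r add0r.
Qed.

Lemma fvol_opp K : convex_body K -> fvol (homothet (-1) 0 K) = fvol K.
Proof.
move=> bK; apply/eqP; rewrite eq_le fvol_le_opp// andbT.
have N10 : -1 != 0 :> R by rewrite oppr_eq0 oner_eq0.
have := fvol_le_opp (homothet_convex_body 0 N10 bK).
by have := @homothetK R n (-1) 0 K N10; rewrite invrN1 scaler0 => ->.
Qed.

Lemma fvol_homothet s a K : s != 0 -> convex_body K ->
  fvol (homothet s a K) = `|s| ^+ n.+1 * fvol K.
Proof.
move=> s0 bK; have [sp|sn|/eqP] := ltgtP 0 s; last by rewrite eq_sym (negbTE s0).
  by rewrite /fvol vol_homothet// convex_body_volE// -EFinM/= gtr0_norm.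
have -> : homothet s a K = homothet (- s) a (homothet (-1) 0 K).
  by rewrite homothet_comp mulrN1 opprK scaler0 addr0.
have N10 : -1 != 0 :> R by rewrite oppr_eq0 oner_eq0.
rewrite {1}/fvol vol_homothet ?oppr_gt0// (convex_body_volE (homothet_convex_body _ _ _))//.
by rewrite -EFinM/= fvol_opp// ltr0_norm.
Qed.

Lemma fvol_translate a K : convex_body K -> fvol (translate K a) = fvol K.
Proof. by move=> bK; rewrite homothet_translate fvol_homothet ?oner_eq0// normr1 expr1n mul1r. Qed.

Lemma fvol_mono K1 K2 : K1 `<=` K2 -> compact K2 -> fvol K1 <= fvol K2.
Proof.
move=> K12 cK2; have [M _ KM] := compact_norm_bound cK2.
rewrite fine_le ?vol_mono// ?(vol_fin KM)//.
by apply: (@vol_fin _ _ _ M) => x /K12/KM.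
Qed.

(** A small copy of the cube [Q] fits into [K], and the grid sum of [Q], equal to [2 ^+ n.+1 >= 2],
    exceeds its volume by at most 1. *)
Lemma fvol_gt0 K : convex_body K -> 0 < fvol K.
Proof.
case=> cK _ [c /interior_normP[e e0 ce]].
pose Q : set 'rV[R]_n.+1 := [set x | forall i, `[(-1), 1]%classic (x ord0 i)].
have cQ : compact Q by refine (@rV_compact _ _ (fun=> _) _) => i; exact: segment_compact.
have [N] := filter_ex (grid_sum_le_vol 1 cQ ltr01).
have h0 := @mesh_gt0 R N; have hN : mesh N * N.+1%:R = 1 :> R by rewrite mulVf// pnatr_eq0.
have -> : grid_sum 1 N \1_Q = 2 ^+ n.+1.
  rewrite /grid_sum (eq_bigr (fun=> mesh N ^+ n.+1)) => [|k _].
    rewrite sumr_const card_ffun !card_ord -[LHS]mulr_natr natrX -exprMn muln1.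
    by rewrite natrM mulrCA hN mulr1.
  rewrite indicE mem_set ?mulr1// => i; rewrite mxE /node /= in_itv/=.
  have kN : (k i)%:R + 1 <= 2 * N.+1%:R :> R.
    by rewrite natr1 -natrM ler_nat; exact: (ltn_ord (k i)).
  have : @mesh R N * ((k i)%:R + 1) <= mesh N * (2 * N.+1%:R) by rewrite ler_pM2l.
  rewrite [leRHS]mulrCA hN => kN'.
  have : 0 <= @mesh R N * (k i)%:R by rewrite mulr_ge0// ltW.
  lra.
rewrite exprS => Q2.
have Q0 : 0 < fvol Q.
  have : 1 <= 2 ^+ n :> R by rewrite exprn_ege1// ler1n.
  by rewrite -/(fvol Q) in Q2; set p := 2 ^+ n in Q2 * => p1; lra.
have e20 : 0 < e / 2 by rewrite divr_gt0.
apply: lt_le_trans (_ : fvol (homothet (e / 2) c Q) <= _).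
  by rewrite /fvol vol_homothet// compact_volE// -EFinM/= mulr_gt0// exprn_gt0.
apply: fvol_mono => // _ [x Qx <-]; apply: ce.
rewrite opprD addrA subrr sub0r normrN normrZ gtr0_norm//.
have : `|x| <= 1.
  by apply: norm_le_coord => // i; have := Qx i; rewrite /= in_itv/= ler_norml.
by move=> x1; rewrite (le_lt_trans (ler_wpM2l (ltW e20) x1))//; lra.
Qed.

End ConvexVolume.

(** * Euclidean balls, counting and densities *)

Section EuclideanBall.
Context {R : realType} {n : nat}.
Implicit Types (x y : 'rV[R]_n.+1) (r s : R).

Local Notation E := (@euclidean_ball R n.+1).

Lemma euclidean_ballE r x : 0 <= r -> E r x <-> \sum_i x ord0 i ^+ 2 <= r ^+ 2.
Proof.
move=> r0; rewrite /euclidean_ball/=; split=> h; last first.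
  by rewrite -(ger0_norm r0) -sqrtr_sqr ler_wsqrtr.
rewrite -[leLHS]sqr_sqrtr ?lerXn2r ?nnegrE ?sqrtr_ge0//.
by apply: sumr_ge0 => i _; exact: sqr_ge0.
Qed.

Lemma euclidean_ball_mono r s : r <= s -> E r `<=` E s.
Proof. by move=> rs x /le_trans; apply. Qed.

Lemma euclidean_ball_homothet s r : 0 < s -> 0 <= r -> homothet s 0 (E r) = E (s * r).
Proof.
move=> s0 r0; apply/seteqP; split=> x; rewrite homothetE ?gt_eqF// subr0.
  rewrite !euclidean_ballE ?mulr_ge0 ?(ltW s0)// exprMn => h.
  rewrite -ler_pdivrMl ?exprn_gt0// mulr_sumr; apply: le_trans h.
  by apply: ler_sum => i _; rewrite mxE exprMn exprVn.
rewrite !euclidean_ballE ?mulr_ge0 ?(ltW s0)// exprMn => h.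
rewrite -ler_pdivrMl ?exprn_gt0// mulr_sumr in h; apply: le_trans h.
by apply: ler_sum => i _; rewrite mxE exprMn exprVn.
Qed.

Lemma euclidean_ball_opp r x : E r x -> E r (- x).
Proof.
rewrite /euclidean_ball/=; have -> // : \sum_i (- x) ord0 i ^+ 2 = \sum_i x ord0 i ^+ 2.
by apply: eq_bigr => i _; rewrite mxE sqrrN.
Qed.

(** In each coordinate the convexity defect of the square is [t (1 - t) (x_i - y_i)^2]. *)
Lemma euclidean_ball_convex r : 0 <= r ->
  convex_set (E r : set (convex_lmodType 'rV[R]_n.+1)).
Proof.
move=> r0; apply/convex_setP => x y t; rewrite !euclidean_ballE// => xr yr /andP[t0 t1].
apply: le_trans (_ : t * \sum_i x ord0 i ^+ 2 + (1 - t) * \sum_i y ord0 i ^+ 2 <= _).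
  rewrite !mulr_sumr -big_split/=; apply: ler_sum => i _; rewrite !mxE.
  have : 0 <= t * (1 - t) * (x ord0 i - y ord0 i) ^+ 2.
    by apply: mulr_ge0; [apply: mulr_ge0; rewrite ?subr_ge0|exact: sqr_ge0].
  by nra.
have t10 : 0 <= 1 - t by rewrite subr_ge0.
have := ler_wpM2l t0 xr; have := ler_wpM2l t10 yr; lra.
Qed.

(** The triangle inequality from convexity: [x + y] is a convex combination of [x] and [y], each
    rescaled to the ball of radius [r + s]. *)
Lemma euclidean_ballD r s x y : 0 < r -> 0 < s -> E r x -> E s y -> E (r + s) (x + y).
Proof.
move=> r0 s0 xr ys; have rs0 : 0 < r + s by rewrite addr_gt0.
have scale (u : R) z : 0 < u -> E u z -> E (r + s) ((r + s) / u *: z).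
  move=> u0 zu; have -> : r + s = (r + s) / u * u by rewrite divfK// gt_eqF.
  rewrite -euclidean_ball_homothet ?divr_gt0// ?ltW//.
  by exists z; rewrite // add0r divfK// gt_eqF.
have := euclidean_ball_convex (ltW rs0) => /convex_setP.
move=> /(_ ((r + s) / r *: x) ((r + s) / s *: y) (r / (r + s))).
have -> : r / (r + s) *: ((r + s) / r *: x) + (1 - r / (r + s)) *: ((r + s) / s *: y) = x + y.
  rewrite !scalerA; congr (_ + _).
    by rewrite -[RHS]scale1r; congr (_ *: _); field; rewrite !gt_eqF.
  by rewrite -[RHS]scale1r; congr (_ *: _); field; rewrite !gt_eqF.
apply; [exact: scale|exact: scale|].
by apply/andP; split; [rewrite divr_ge0// ltW|rewrite ler_pdivrMr// mul1r lerDl ltW].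
Qed.

Lemma norm_sub_euclidean_ball r x : `|x| <= r -> E (n.+1%:R * r) x.
Proof.
move=> xr; have r0 : 0 <= r by rewrite (le_trans _ xr).
rewrite euclidean_ballE ?mulr_ge0//.
apply: le_trans (_ : \sum_(i < n.+1) r ^+ 2 <= _).
  apply: ler_sum => i _; rewrite -real_normK ?num_real//.
  by rewrite lerXn2r ?nnegrE// (le_trans (coord_le_norm _ _)).
rewrite sumr_const card_ord -[leLHS]mulr_natl exprMn ler_wpM2r ?sqr_ge0//.
by rewrite -natrX ler_nat expnS expn1 leq_pmulr.
Qed.

Lemma euclidean_ball_norm r x : 0 <= r -> E r x -> `|x| <= r.
Proof.
move=> r0; rewrite euclidean_ballE// => xr; apply: norm_le_coord => // i.
rewrite -(ger0_norm r0) -ler_sqr ?nnegrE// !real_normK ?num_real//.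
by apply: le_trans xr; rewrite (bigD1 i)//= lerDl sumr_ge0// => j _; exact: sqr_ge0.
Qed.

Lemma euclidean_ball_convex_body r : 0 < r -> convex_body (E r).
Proof.
move=> r0; split.
- apply: bounded_closed_compact.
    exists r; split=> [|M rM x /(euclidean_ball_norm (ltW r0))]; first exact: num_real.
    by move=> /le_trans; apply; exact: ltW.
  have cont (s : seq 'I_n.+1) : continuous (fun x : 'rV[R]_n.+1 => \sum_(i <- s) x ord0 i ^+ 2).
    elim: s => [|i s IH].
      by under eq_fun do rewrite big_nil; exact: cst_continuous.
    under eq_fun do rewrite big_cons.
    move=> x; apply: (@continuousD _ _ _ (fun x : 'rV[R]_n.+1 => x ord0 i ^+ 2)); last exact: IH.
    refine (@continuous_comp _ _ _ (fun x : 'rV[R]_n.+1 => x ord0 i) (fun y : R => y ^+ 2) x _ _).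
      exact: coord_continuous.
    exact: exprn_continuous.
  have -> : E r = (fun x : 'rV[R]_n.+1 => \sum_i x ord0 i ^+ 2) @^-1` [set y | y <= r ^+ 2].
    by apply/seteqP; split=> x; rewrite euclidean_ballE// ltW.
  by apply: preimage_closed => [x _|]; [exact: cont|exact: closed_le].
- exact: euclidean_ball_convex (ltW r0).
- exists 0; apply/interior_normP; exists (r / n.+1%:R); first by rewrite divr_gt0.
  move=> y; rewrite sub0r normrN => /ltW/norm_sub_euclidean_ball.
  by rewrite mulrC divfK// pnatr_eq0.
Qed.

Definition unit_ball_vol : R := fvol (E 1).

Lemma unit_ball_vol_gt0 : 0 < unit_ball_vol.
Proof. exact/fvol_gt0/euclidean_ball_convex_body. Qed.

Lemma fvol_euclidean_ball r : 0 < r -> fvol (E r) = unit_ball_vol * r ^+ n.+1.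
Proof.
move=> r0; rewrite -[r in LHS]mulr1 -euclidean_ball_homothet//.
rewrite fvol_homothet ?gt_eqF ?gtr0_norm// 1?mulrC//.
exact: euclidean_ball_convex_body.
Qed.

Lemma compact_sub_ball (K : set 'rV[R]_n.+1) : compact K -> exists2 c, 0 < c & K `<=` E c.
Proof.
move=> /compact_norm_bound[M M0 KM]; exists (n.+1%:R * M); first by rewrite mulr_gt0.
by move=> x /KM; exact: norm_sub_euclidean_ball.
Qed.

End EuclideanBall.
Arguments unit_ball_vol R n : clear implicits.

(** * Upper and lower limits at infinity *)

Section LimSup.
Context {R : realType}.
Implicit Types (f : R -> \bar R) (q : \bar R) (M : R).

Lemma limf_esup_pinfty_gt f q M : (q < limf_esup f (pinfty_nbhs R))%E ->
  exists2 r, M < r & (q < f r)%E.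
Proof.
rewrite limf_esupE => qf.
have : (q < ereal_sup (f @` [set r : R | (M < r)%R]))%E.
  apply: lt_le_trans qf _; apply: ereal_inf_lbound.
  by exists [set r : R | (M < r)%R] => //; exists M; split; rewrite ?num_real.
by move=> /ereal_sup_gt[_ [r Mr <-] qr]; exists r.
Qed.

Lemma limf_esup_pinfty_ge f q : (forall M, exists2 r, M < r & (q <= f r)%E) ->
  (q <= limf_esup f (pinfty_nbhs R))%E.
Proof.
move=> qf; rewrite limf_esupE; apply: le_ereal_inf_tmp => _ [V [M [_ MV]] <-].
have [r Mr qr] := qf M; apply: le_trans qr _; apply: ereal_sup_ubound.
by exists r => //; exact: MV.
Qed.

Lemma limf_einf_pinfty_lt f q M : (limf_einf f (pinfty_nbhs R) < q)%E ->
  exists2 r, M < r & (f r < q)%E.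
Proof.
rewrite /limf_einf lteNl => /(limf_esup_pinfty_gt M)[r Mr].
by rewrite lteN2 => rq; exists r.
Qed.

Lemma limf_einf_pinfty_le f q : (forall M, exists2 r, M < r & (f r <= q)%E) ->
  (limf_einf f (pinfty_nbhs R) <= q)%E.
Proof.
move=> fq; rewrite /limf_einf leeNl; apply: limf_esup_pinfty_ge => M.
by have [r Mr rq] := fq M; exists r => //=; rewrite leeN2.
Qed.

End LimSup.

(** An infinite set would contain a finite subset of more than [B / V] points. *)
Lemma finite_set_card_bound (R : realType) (T : choiceType) (A : set T) (V B : R) : 0 < V ->
  (forall F : {fset T}, [set` F] `<=` A -> #|` F|%:R * V <= B) -> finite_set A.
Proof.
move=> V0 AB; apply: contrapT => Ainf.
have [F FA] := infinite_set_fset (Num.truncn (B / V)).+1 Ainf.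
have := AB F FA; rewrite -ler_pdivlMr// => FB FN.
have := lt_le_trans (truncnS_gt (B / V)) (_ : _ <= #|` F|%:R).
by rewrite ler_nat => /(_ FN); rewrite ltNge FB.
Qed.

(** * Counting translates in balls *)

Section Counting.
Context {R : realType} {n : nat}.
Implicit Types (x y : 'rV[R]_n.+1) (A C : set 'rV[R]_n.+1) (r s c : R).

Local Notation E := (@euclidean_ball R n.+1).

(** Stronger than consisting of isolated points, which permits accumulation outside [A]. For
    packings and coverings it is derived from volume bounds. *)
Definition locally_finite A := forall r, finite_set (A `&` E r).

(** Meaningful only when the intersection is finite, since [fset_set] returns a default value on
    infinite sets. *)
Definition ball_points A r : {fset 'rV[R]_n.+1} := fset_set (A `&` E r).

Definition ball_count A r : R := (#|` ball_points A r|)%:R.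

Lemma ball_pointsP A r x : locally_finite A -> x \in ball_points A r -> A x /\ E r x.
Proof. by move=> Af; rewrite in_fset_set// => /set_mem. Qed.

Lemma mem_ball_points A r x : locally_finite A -> A x -> E r x -> x \in ball_points A r.
Proof. by move=> Af Ax rx; rewrite in_fset_set//; exact: mem_set. Qed.

Lemma ball_count_mono A r s : locally_finite A -> r <= s -> ball_count A r <= ball_count A s.
Proof.
move=> Af rs; rewrite ler_nat; apply: uniq_leq_size; first exact: fset_uniq.
by move=> x /(ball_pointsP Af)[Ax rx]; apply: mem_ball_points => //; exact: euclidean_ball_mono rx.
Qed.

Lemma locally_finite_isolated A : locally_finite A -> A `<=` isolated A.
Proof.
move=> Af x Ax; split; first exact: mem_set.
pose r : R := n.+1%:R * (`|x| + 1).
(* The least distance to the finitely many other points nearby; the cap 1 keeps the neighbourhood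
   inside the ball where they are counted. *)
pose e := \big[Num.min/1]_(y : ball_points A r | val y != x) `|x - val y|.
have e0 : 0 < e.
  by apply/bigmin_gtP; split=> // y yx; rewrite normr_gt0 subr_eq0 eq_sym.
have e1 : e <= 1 by exact: bigmin_le_id.
exists [set y | `|x - y| < e].
  by apply/nbhs_ballP; exists e => // y; rewrite mx_norm_ball.
apply/seteqP; split=> [y [/= xy Ay]|_ ->]; last by split=> //=; rewrite subrr normr0.
apply: contrapT => /eqP yx.
have yr : y \in ball_points A r.
  apply: mem_ball_points => //; apply: norm_sub_euclidean_ball.
  rewrite -[y](subKr x) (le_trans (ler_normB _ _))// lerD2l ltW//.
  exact: lt_le_trans e1.
by have /bigmin_gtP[_ /(_ [` yr]%fset yx)] := xy; rewrite ltxx.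
Qed.

Lemma sum_indic_disjoint (I : finType) (K : I -> set 'rV[R]_n.+1) (Y : set 'rV[R]_n.+1) x :
  (forall i j, i <> j -> K i `&` K j = set0) -> (forall i, K i `<=` Y) ->
  \sum_i \1_(K i) x <= \1_Y x :> R.
Proof.
move=> Kd KY; have [[i Kx]|noK] := pselect (exists i, K i x).
  rewrite (bigD1 i)//= big1 => [|j /eqP ji].
    by rewrite addr0 !indicE !mem_set//; exact: KY Kx.
  rewrite indicE memNset// => Kjx.
  by have : (K j `&` K i) x by []; rewrite Kd.
rewrite big1 ?indicE ?ler0n// => i _; rewrite indicE memNset// => Kx.
by apply: noK; exists i.
Qed.

Lemma packing_volume (I : finType) (K : I -> set 'rV[R]_n.+1) r : 0 < r ->
  (forall i, convex_body (K i)) -> (forall i j, i <> j -> (K i)° `&` (K j)° = set0) ->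
  (forall i, K i `<=` E r) -> \sum_i fvol (K i) <= unit_ball_vol R n * r ^+ n.+1.
Proof.
move=> r0 bK Kd Kr; rewrite -fvol_euclidean_ball//.
have := @volume_le _ _ I unit K (fun=> E r) bK.
rewrite big_const iter_addr_0 card_unit mulr1n; apply=> [_|x].
  by have [] := @euclidean_ball_convex_body R n r r0.
rewrite big_const iter_addr_0 card_unit mulr1n.
apply: sum_indic_disjoint => // i; exact: subset_trans (@interior_subset _ _) (Kr i).
Qed.

Section Density.
Variables (C A : set 'rV[R]_n.+1) (c s : R).
Hypotheses (bC : convex_body C) (c0 : 0 < c) (Cc : C `<=` E c).

Lemma translate_sub_ball a r : 0 < r -> E r a -> translate C a `<=` E (r + c).
Proof. by move=> r0 ra _ [x /Cc xc <-]; rewrite addrC; exact: euclidean_ballD. Qed.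

Lemma translate_meet_ball a r : 0 < r -> (translate C a `&` E r) !=set0 -> E (r + c) a.
Proof.
move=> r0 [_ [[x /Cc xc <-] xar]].
by rewrite -[a](addKr x) addrC; apply: euclidean_ballD => //; exact: euclidean_ball_opp.
Qed.

Hypothesis s0 : 0 < s.

Lemma density_in_ballE : density_in_ball C A s =
  ((\esum_(a in A) vol (translate C a `&` E s)) * ((unit_ball_vol R n * s ^+ n.+1)^-1)%:E)%E.
Proof.
rewrite /density_in_ball convex_body_volE; last exact: euclidean_ball_convex_body.
by rewrite fvol_euclidean_ball// inver gt_eqF// mulr_gt0 ?exprn_gt0// unit_ball_vol_gt0.
Qed.

Lemma ball_vol_gt0 : 0 < unit_ball_vol R n * s ^+ n.+1.
Proof. by rewrite mulr_gt0 ?exprn_gt0// unit_ball_vol_gt0. Qed.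

(** Stated for an arbitrary finite [F] because it also serves to derive local finiteness of a
    covering. *)
Lemma esum_card_le_density (F : {fset 'rV[R]_n.+1}) :
  (forall a, a \in F -> A a /\ translate C a `<=` E s) ->
  ((#|` F|%:R * fvol C)%:E <= \esum_(a in A) vol (translate C a `&` E s))%E.
Proof.
move=> FA; apply: esum_ge; exists [set` F].
  by split; [exact: finite_fset|move=> a /FA[]].
rewrite fsbig_finite ?finite_fset//= set_fsetK.
rewrite (eq_big_seq (fun=> (fvol C)%:E)) => [|a /FA[_ aE]].
  by rewrite sumEFin big_const_seq iter_addr_0 count_predT mulr_natl.
rewrite (setIidl aE) convex_body_volE; last exact: translate_convex_body.
by rewrite fvol_translate.
Qed.

Hypothesis Af : locally_finite A.

(** Translates centred within [s - c] lie in the ball; in [density_in_ball_le], those that meet the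
    ball are centred within [s + c]. *)
Lemma density_in_ball_ge : c < s ->
  ((ball_count A (s - c) * fvol C / (unit_ball_vol R n * s ^+ n.+1))%:E
   <= density_in_ball C A s)%E.
Proof.
move=> cs; rewrite density_in_ballE EFinM lee_pmul2r ?lte_fin ?invr_gt0 ?ball_vol_gt0//.
apply: esum_card_le_density => a /(ball_pointsP Af)[Aa ra]; split=> //.
by rewrite -[s](subrK c); apply: translate_sub_ball; rewrite ?subr_gt0.
Qed.

Lemma density_in_ball_le :
  (density_in_ball C A s <=
   (ball_count A (s + c) * fvol C / (unit_ball_vol R n * s ^+ n.+1))%:E)%E.
Proof.
rewrite density_in_ballE EFinM lee_pmul2r ?lte_fin ?invr_gt0 ?ball_vol_gt0//.
have -> : (\esum_(a in A) vol (translate C a `&` E s) =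
    \esum_(a in A `&` E (s + c)) vol (translate C a `&` E s))%E.
  rewrite esum_mkcondr; apply: eq_esum => a Aa.
  case: ifPn => // aE; have -> : translate C a `&` E s = set0; last exact: vol_set0.
  apply: contrapT => /eqP/set0P/(translate_meet_ball s0).
  by move: aE; rewrite notin_setE.
rewrite esum_fset//; last by move=> a _; exact: vol_ge0.
rewrite fsbig_finite//=.
apply: le_trans (_ : (\sum_(a <- ball_points A (s + c)) (fvol C)%:E)%E <= _)%E; last first.
  by rewrite sumEFin big_const_seq iter_addr_0 count_predT mulr_natl.
apply: lee_sum => a _; rewrite -(fvol_translate a bC) -convex_body_volE.
  by apply: vol_mono; exact: subIsetl.
exact: translate_convex_body.
Qed.

End Density.

Lemma expr_shift_le (k eta : R) : 0 <= k -> 0 < eta ->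
  exists2 M, 0 < M & forall r, M < r -> (r + k) ^+ n.+1 <= (1 + eta) * r ^+ n.+1.
Proof.
move=> k0 eta0.
(* Beyond this [M] one has [n.+1 * t * (1 + eta) <= eta] for [t = k / (r + k)], as the Bernoulli
   bound below requires. *)
pose M := n.+1%:R * k * (1 + eta) / eta + 1.
have M0 : 0 < M by rewrite ltr_wpDl// !mulr_ge0// ?invr_ge0 ?addr_ge0// ltW.
exists M => // r Mr; have r0 := lt_trans M0 Mr.
have rk0 : 0 < r + k by rewrite ltr_wpDr.
pose t := k / (r + k).
have tE : t * (r + k) = k by rewrite divfK// gt_eqF.
have t01 : 0 <= t <= 1.
  by rewrite divr_ge0 ?(ltW rk0)//= ler_pdivrMr// mul1r lerDr ltW.
have -> : r = (1 - t) * (r + k) by rewrite mulrBl tE mul1r addrK.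
have -> : (1 - t) * (r + k) + k = r + k by rewrite mulrBl tE mul1r addrK.
rewrite exprMn mulrA -[leLHS]mul1r ler_wpM2r ?exprn_ge0 ?(ltW rk0)//.
apply: le_trans (ler_wpM2l _ (bernoulli_le n.+1 t01)); last by rewrite addr_ge0// ltW.
have : n.+1%:R * t * (1 + eta) <= eta; last by lra.
have tk : t <= k / r by rewrite ler_wpM2l// lef_pV2// lerDl.
have : n.+1%:R * k * (1 + eta) <= eta * r.
  have : M <= r by exact: ltW.
  by rewrite -lerBrDr ler_pdivrMr// mulrC => /le_trans; apply; nra.
rewrite -ler_pdivrMr// => h; apply: le_trans h.
rewrite [leRHS]mulrAC ler_wpM2r ?addr_ge0// ?(ltW eta0)// -mulrA ler_wpM2l//.
Qed.

End Counting.

(** * From packings to coverings *)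

(** Zorn's lemma on the pairwise compatible subsets. The last clause has both [e x y] and [e y x]
    because [e] is an arbitrary relation. *)
Lemma maximal_pairwise (T : Type) (U : set T) (e : T -> T -> Prop) : exists X : set T,
  [/\ X `<=` U, forall x y, X x -> X y -> x <> y -> e x y &
      forall y, U y -> X y \/ exists2 x, X x & ~ (e x y /\ e y x)].
Proof.
pose P X := X `<=` U /\ forall x y, X x -> X y -> x <> y -> e x y.
have [F FP Ftot|X [[XU Xe] Xmax]] := @Zorn_bigcup T P.
  split=> [x [X /FP[XU _]]|x y [X FX Xx] [Y FY Yy] xy]; first exact: XU.
  have [XY|YX] := Ftot X Y FX FY.
    by have [_] := FP Y FY; apply=> //; exact: XY.
  by have [_] := FP X FX; apply=> //; exact: YX.
exists X; split=> // y Uy; apply: contrapT => /not_orP[Xy /forall2NP noX].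
have ye x : X x -> e x y /\ e y x by have [|/contrapT] := noX x.
apply: (Xmax (X `|` [set y])).
  by split=> [x Xx|/(_ y (or_intror erefl))]; [left|].
split=> [x [/XU//|->//]|x z [Xx|->] [Xz|->]] //; first exact: Xe.
- by have [] := ye _ Xx.
- by have [] := ye _ Xz.
Qed.

Section PackingToCovering.
Context {R : realType} {n : nat}.
Variables (C : set 'rV[R]_n.+1) (l : R).
Hypotheses (bC : convex_body C) (l0 : 0 < l) (l1 : l <= 1).

Local Notation E := (@euclidean_ball R n.+1).

(** With [- y = k y1 + v], the points [x] and [y1] get the weights [l] and [l k]. As [l k <= 1], the
    weight [1 - l k] completes the total to [1 + l]; it goes to a fixed point [c0] of [C], and [t]
    absorbs its contribution. *)
Lemma difference_body_sub (k : R) (v : 'rV[R]_n.+1) : 0 <= k -> l * k <= 1 ->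
  (forall x, C x -> exists2 y, C y & - x = k *: y + v) ->
  exists t, forall x y, C x -> C y -> exists2 z, C z & l *: (x - y) = t + (1 + l) *: z.
Proof.
move=> k0 lk1 Ck; have [_ /convex_setP cC [c0 /interior_subset Cc0]] := bC.
exists (l *: v - (1 - l * k) *: c0) => x y Cx /Ck[y1 Cy1 yE].
have lp : 0 < 1 + l by rewrite addr_gt0.
exists (l / (1 + l) *: x + (1 - l / (1 + l)) *: ((l * k) *: y1 + (1 - l * k) *: c0)).
  apply: (cC) => //; first by apply: (cC) => //; rewrite lk1 mulr_ge0// ltW.
  by rewrite divr_ge0 ?(ltW l0) ?(ltW lp)//= ler_pdivrMr// mul1r lerDr.
rewrite yE; apply/rowP => i; rewrite !mxE; field; exact: lt0r_neq0.
Qed.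

Lemma homothet_opp_sub_ball x r c : 0 < r -> 0 < c -> C `<=` E c -> E r x ->
  homothet (- l) x C `<=` E (r + c).
Proof.
move=> r0 c0 Cc xr _ [y Cy <-]; apply: euclidean_ballD => //.
rewrite scaleNr; apply: euclidean_ball_opp.
apply: (@euclidean_ball_mono _ _ (l * c)); first by rewrite ler_piMl// ltW.
by rewrite -euclidean_ball_homothet ?ltW//; exists y; rewrite ?add0r//; exact: Cc.
Qed.

Variables (A X : set 'rV[R]_n.+1).
Hypotheses (packA : packing C A)
  (XA : forall x a z, X x -> A a -> C z -> x <> a + (1 + l) *: z)
  (Xdisj : forall x y, X x -> X y -> x <> y ->
    homothet (- l) x C `&` homothet (- l) y C = set0).

Lemma greedy_volume r c (F G : {fset 'rV[R]_n.+1}) : 0 < r -> 0 < c -> C `<=` E c ->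
  [set` F] `<=` A `&` E r -> [set` G] `<=` X `&` E r ->
  #|` F|%:R * fvol C + #|` G|%:R * (l ^+ n.+1 * fvol C) <=
  unit_ball_vol R n * (r + c) ^+ n.+1.
Proof.
move=> r0 c0 Cc FA GX; have [_ Adisj] := packA.
have [_ /convex_setP cC _] := bC.
have lp : 0 < 1 + l by rewrite addr_gt0.
have Nl0 : - l != 0 by rewrite oppr_eq0 gt_eqF.
pose K (i : F + G) := match i with
  | inl a => translate C (val a) | inr x => homothet (- l) (val x) C end.
(* A common point would give [x = a + y + l z], and [y + l z] lies in [(1 + l) C] by convexity,
   against [XA]. *)
have FG (a : F) (x : G) : translate C (val a) `&` homothet (- l) (val x) C = set0.
  rewrite -subset0 => _ [[y Cy <-] [z Cz xz]].
  have [Aa _] := FA _ (valP a); have [Xx _] := GX _ (valP x).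
  apply: (XA Xx Aa (z := l / (1 + l) *: z + (1 - l / (1 + l)) *: y)).
    apply: (cC) => //; rewrite divr_ge0 ?(ltW l0) ?(ltW lp)//=.
    by rewrite ler_pdivrMr// mul1r lerDr.
  apply/rowP => i; move/rowP: xz => /(_ i); rewrite !mxE => xz.
  have -> : val x ord0 i = y ord0 i + val a ord0 i + l * z ord0 i by rewrite -xz; ring.
  by field; exact: lt0r_neq0.
have := @packing_volume R n (F + G)%type K (r + c); rewrite big_sumType/=.
have -> : \sum_(a : F) fvol (translate C (val a)) = #|` F|%:R * fvol C.
  by under eq_bigr do rewrite fvol_translate//; rewrite sumr_const cardfE mulr_natl.
have -> : \sum_(x : G) fvol (homothet (- l) (val x) C) = #|` G|%:R * (l ^+ n.+1 * fvol C).
  under eq_bigr do rewrite fvol_homothet// normrN gtr0_norm//.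
  by rewrite sumr_const cardfE mulr_natl.
apply=> [|[a|x]|[a|x] [b|y] ab|[a|x]] /=.
- exact: addr_gt0.
- exact: translate_convex_body.
- exact: homothet_convex_body.
- have [Aa _] := FA _ (valP a); have [Ab _] := FA _ (valP b).
  by apply: Adisj => // /val_inj abE; apply: ab; rewrite abE.
- by apply: subsetI_eq0 (FG a y); exact: interior_subset.
- by rewrite setIC; apply: subsetI_eq0 (FG b x); exact: interior_subset.
- have [Xx _] := GX _ (valP x); have [Xy _] := GX _ (valP y).
  apply: subsetI_eq0 (Xdisj Xx Xy _); try exact: interior_subset.
  by move=> /val_inj xyE; apply: ab; rewrite xyE.
- by have [_ ar] := FA _ (valP a); exact: translate_sub_ball.
- by have [_ xr] := GX _ (valP x); exact: homothet_opp_sub_ball.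
Qed.

End PackingToCovering.

Section CoveringFromPacking.
Context {R : realType} {n : nat}.
Implicit Types (C A X : set 'rV[R]_n.+1).

Local Notation E := (@euclidean_ball R n.+1).

Lemma locally_finite_sub_image A B (f : 'rV[R]_n.+1 -> 'rV[R]_n.+1) (g : R -> R) :
  locally_finite A -> (forall r, 0 < r -> B `&` E r `<=` f @` (A `&` E (g r))) ->
  locally_finite B.
Proof.
move=> Af Bf r; apply: (@sub_finite_set _ _ (B `&` E (`|r| + 1))).
  move=> x [Bx rx]; split=> //; apply: euclidean_ball_mono rx.
  by rewrite (le_trans (ler_norm _))// lerDl.
apply: sub_finite_set (Bf _ _) _; last exact: finite_image.
by rewrite ltr_wpDl.
Qed.

Lemma locally_finite_bounded A (V : R) (B : R -> R) : 0 < V ->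
  (forall r (F : {fset 'rV[R]_n.+1}), 0 < r -> [set` F] `<=` A `&` E r ->
     #|` F|%:R * V <= B r) -> locally_finite A.
Proof.
move=> V0 AB r; apply: (@sub_finite_set _ _ (A `&` E (`|r| + 1))).
  move=> x [Ax rx]; split=> //; apply: euclidean_ball_mono rx.
  by rewrite (le_trans (ler_norm _))// lerDl.
by apply: finite_set_card_bound V0 _ => F FA; apply: AB FA; rewrite ltr_wpDl.
Qed.

Lemma locally_finiteU A B : locally_finite A -> locally_finite B -> locally_finite (A `|` B).
Proof. by move=> Af Bf r; rewrite setIUl finite_setU. Qed.

Lemma scaled_arrangement A (s : R) : 0 < s -> infinite_set A -> locally_finite A ->
  locally_finite [set s *: y | y in A] /\ infinite_discrete [set s *: y | y in A].
Proof.
move=> s0 Ainf Af.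
have sAf : locally_finite [set s *: y | y in A].
  apply: (@locally_finite_sub_image A _ (fun y => s *: y) (fun r => s^-1 * r)) => // r r0.
  move=> _ [[y Ay <-] yr]; exists y => //; split=> //.
  rewrite -euclidean_ball_homothet ?invr_gt0 ?ltW//; exists (s *: y) => //.
  by rewrite add0r scalerA mulVf ?gt_eqF// scale1r.
split=> //; split; last exact: locally_finite_isolated.
move=> sAfin; apply: Ainf.
have -> : A = (fun y => s^-1 *: y) @` [set s *: y | y in A].
  apply/seteqP; split=> [y Ay|_ [_ [y Ay <-] <-]].
    by exists (s *: y); [exists y|rewrite scalerA mulVf ?gt_eqF// scale1r].
  by rewrite scalerA mulVf ?gt_eqF// scale1r.
exact: finite_image.
Qed.

Lemma ball_count_scale A (s r : R) : 0 < s -> 0 < r -> locally_finite A ->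
  locally_finite [set s *: y | y in A] ->
  ball_count [set s *: y | y in A] (s * r) = ball_count A r.
Proof.
move=> s0 r0 Af sAf; congr _%:R.
have s_neq0 : s != 0 by rewrite gt_eqF.
have sinj : injective (fun y : 'rV[R]_n.+1 => s *: y) by exact: scalerI.
transitivity (size [seq s *: y | y <- ball_points A r]); last by rewrite size_map.
apply/perm_size/uniq_perm; [exact: fset_uniq|by rewrite map_inj_uniq// fset_uniq|].
move=> x; apply/idP/mapP => [/(ball_pointsP sAf)[[y Ay <-]]|[y /(ball_pointsP Af)[Ay ry] ->]].
  rewrite -euclidean_ball_homothet ?ltW// => -[z zr]; rewrite add0r => /sinj zy.
  by exists y => //; apply: mem_ball_points => //; rewrite -zy.
apply: mem_ball_points => //; first by exists y.
by rewrite -euclidean_ball_homothet ?ltW//; exists y; rewrite ?add0r.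
Qed.

Lemma ball_countU_shift A X (t : 'rV[R]_n.+1) (r u : R) : 0 < r -> 0 < u -> E u (- t) ->
  locally_finite A -> locally_finite X -> locally_finite [set x + t | x in X] ->
  ball_count (A `|` [set x + t | x in X]) r <= ball_count A r + ball_count X (r + u).
Proof.
move=> r0 u0 tu Af Xf Xtf; rewrite -natrD ler_nat.
have -> : (#|` ball_points A r| + #|` ball_points X (r + u)|)%N =
    size ((ball_points A r : seq _) ++ [seq x + t | x <- ball_points X (r + u)]).
  by rewrite size_cat size_map.
apply: uniq_leq_size; first exact: fset_uniq.
move=> y /(ball_pointsP (locally_finiteU Af Xtf))[[Ay|[x Xx <-]] yr]; rewrite mem_cat.
  by rewrite mem_ball_points.
apply/orP; right; apply/mapP; exists x => //; apply: mem_ball_points => //.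
by rewrite -[x](addrK t); exact: euclidean_ballD.
Qed.

(* With [L = l ^+ n.+1], [p] the volume of the ball, [a] and [x] the volumes of the original
   and of the added copies of [C]: the added small copies fit in the uncovered part. *)
Lemma density_estimate (p a x L eps eta : R) : 0 < L -> L <= 1 ->
  (1 - eps) * p < a -> a + x * L <= (1 + eta) * p ->
  a + x <= (1 - eps + (eps + eta) / L) * p.
Proof.
move=> L0 L1 pa ax; rewrite -(ler_pM2r L0).
have -> : (1 - eps + (eps + eta) / L) * p * L = (1 - eps) * p * L + (eps + eta) * p.
  by field; rewrite gt_eqF.
nra.
Qed.

Lemma covering_density_lt C (k l eps : R) (v : 'rV[R]_n.+1) : convex_body C ->
  0 <= k -> (forall x, C x -> exists2 y, C y & - x = k *: y + v) ->
  0 < l -> l <= 1 -> l * k <= 1 -> 0 < eps ->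
  ((1 - eps)%:E < packing_density C)%E ->
  (covering_density C < ((1 + l) ^+ n.+1 * (1 + eps / l ^+ n.+1))%:E)%E.
Proof.
move=> bC k0 Ck l0 l1 lk1 eps0 /ereal_sup_gt[_ [A packA <-] epsA].
have [t tP] := difference_body_sub bC l0 k0 lk1 Ck.
have [cC _ _] := bC; have [c c0 Cc] := compact_sub_ball cC.
have V0 := fvol_gt0 bC; set V := fvol C in V0.
have lp : 0 < 1 + l by rewrite addr_gt0.
have L0 : 0 < l ^+ n.+1 by rewrite exprn_gt0.
have L1 : l ^+ n.+1 <= 1 by rewrite exprn_ile1// ltW.
(* The points left uncovered by [(1 + l) C + A], among which the maximal [X] is chosen. *)
pose U := [set x : 'rV[R]_n.+1 | forall a z, A a -> C z -> x <> a + (1 + l) *: z].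
have [X [XU Xdisj Xmax]] := maximal_pairwise U (fun x y : 'rV[R]_n.+1 =>
  homothet (- l) x C `&` homothet (- l) y C = set0).
have XA x a z : X x -> A a -> C z -> x <> a + (1 + l) *: z by move=> /XU; exact.
have vol_AX := greedy_volume bC l0 l1 packA XA Xdisj.
have Af : locally_finite A.
  apply: (locally_finite_bounded V0) => r F r0 FA.
  have := vol_AX r c F fset0 r0 c0 Cc FA; rewrite cardfs0 mul0r addr0; apply.
  by move=> x; rewrite /= in_fset0.
have Xf : locally_finite X.
  apply: (locally_finite_bounded (mulr_gt0 L0 V0)) => r F r0 FX.
  have := vol_AX r c fset0 F r0 c0 Cc; rewrite cardfs0 mul0r add0r; apply=> //.
pose Y := [set x + t | x in X].
have [u u0 tu] : exists2 u, 0 < u & E u (- t).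
  exists (n.+1%:R * (`|t| + 1)); first by rewrite mulr_gt0// ltr_wpDl.
  by apply: norm_sub_euclidean_ball; rewrite normrN lerDl.
have Yf : locally_finite Y.
  apply: (@locally_finite_sub_image X _ (fun x => x + t) (fun r => r + u)) => // r r0.
  move=> _ [[x Xx <-] xr]; exists x => //; split=> //.
  by rewrite -[x](addrK t); exact: euclidean_ballD.
have AYf := locally_finiteU Af Yf.
have AYinf : infinite_set (A `|` Y).
  by rewrite finite_setU => -[Afin _]; have [[]] := packA.
have lp' : 0 < (1 + l)^-1 by rewrite invr_gt0.
have [Df Ddisc] := scaled_arrangement lp' AYinf AYf.
set D := [set _ | _ in A `|` Y] in Df Ddisc.
have covD : covering C D.
  split=> //; apply/seteqP; split=> // y _.
  (* Undoing the scaling by [(1 + l)^-1], the claim is that [(1 + l) C] covers space with the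
     translations in [A] and [Y]. *)
  pose y1 := (1 + l) *: y.
  have yE : y = (1 + l)^-1 *: y1 by rewrite scalerA mulVf ?gt_eqF// scale1r.
  suff [z Cz [b AYb y1E]] : exists2 z, C z & exists2 b, (A `|` Y) b & y1 = b + (1 + l) *: z.
    exists ((1 + l)^-1 *: b); first by exists b.
    by exists z => //; rewrite yE y1E scalerDr scalerA mulVf ?gt_eqF// scale1r addrC.
  have [Uy|] := pselect (U y1); last first.
    move=> /existsNP[a /existsNP[z /not_implyP[Aa /not_implyP[Cz /contrapT y1E]]]].
    by exists z => //; exists a => //; left.
  have [x Xx [_ [[z1 Cz1 <-] [z2 Cz2 zE]]]] : exists2 x, X x &
      homothet (- l) x C `&` homothet (- l) y1 C !=set0.
    (* Either maximality provides an [x] whose body meets that of [y1], or [y1] is itself in [X] and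
       serves as [x]. *)
    have [Xy|[x Xx xy]] := Xmax _ Uy; last first.
      exists x => //; apply/set0P/eqP => xy0; apply: xy; split=> //.
      by rewrite setIC.
    have [_ _ [z0 /interior_subset Cz0]] := bC.
    by exists y1 => //; exists (y1 - l *: z0); split; exists z0; rewrite ?scaleNr.
  have [z Cz zt] := tP _ _ Cz2 Cz1; exists z => //.
  exists (x + t); first by right; exists x.
  rewrite -addrA -zt; apply/rowP => i; move/rowP: zE => /(_ i); rewrite !mxE => zE.
  by rewrite -[LHS](addrK (- l * z2 ord0 i)) zE; ring.
(* [K] dominates the radius shifts: [(1 + l) c] for translates meeting the boundary, in the scale
   before division by [1 + l], and [u] for the shift by [t]. *)
pose K := (1 + l) * c + u.
have K0 : 0 < K by rewrite addr_gt0 ?mulr_gt0.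
have cK : c <= K by rewrite /K mulrDl mul1r -addrA lerDl ltW// addr_gt0// mulr_gt0.
(* Divided by [l ^+ n.+1] this is [eps / 2], less than the [eps] subtracted in [T], so [T] is
   strictly below the target. *)
pose eta := eps * l ^+ n.+1 / 2.
have eta0 : 0 < eta by rewrite divr_gt0// mulr_gt0.
pose T := (1 + l) ^+ n.+1 * (1 - eps + (eps + eta) / l ^+ n.+1).
apply: (@le_lt_trans _ _ T%:E); last first.
  rewrite lte_fin ltr_pM2l ?exprn_gt0//.
  have -> : (eps + eta) / l ^+ n.+1 = eps / l ^+ n.+1 + eps / 2.
    by rewrite /eta; field; rewrite gt_eqF.
  lra.
apply: (@le_trans _ _ (lower_density C D)); first by apply: ereal_inf_lbound; exists D.
have [M M0 rM] := @expr_shift_le R n _ _ (ltW (addr_gt0 K0 c0)) eta0.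
apply: limf_einf_pinfty_le => S.
have [r] := limf_esup_pinfty_gt (Num.max (S * (1 + l)) M) epsA.
rewrite gt_max => /andP[Sr Mr] epsr.
have r0 := lt_trans M0 Mr.
exists (r / (1 + l)); first by rewrite ltr_pdivlMr.
set s := r / (1 + l); have s0 : 0 < s by rewrite divr_gt0.
have rE : r = (1 + l) * s by rewrite mulrC divfK// gt_eqF.
pose p := unit_ball_vol R n * r ^+ n.+1.
have p0 : 0 < p by rewrite /p ball_vol_gt0.
have pA : (1 - eps) * p < ball_count A (r + K) * V.
  rewrite -ltr_pdivlMr// -lte_fin (lt_le_trans epsr)//.
  apply: le_trans (density_in_ball_le bC c0 Cc r0 Af) _.
  rewrite lee_fin ler_pM2r ?invr_gt0// ler_wpM2r ?(ltW V0)// ball_count_mono//.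
  by rewrite lerD2l.
have pAX : ball_count A (r + K) * V + ball_count X (r + K) * V * l ^+ n.+1 <= (1 + eta) * p.
  rewrite -mulrA [V * _]mulrC.
  have rK0 : 0 < r + K by rewrite addr_gt0.
  apply: le_trans (vol_AX (r + K) c (ball_points A (r + K)) (ball_points X (r + K)) rK0 c0 Cc _ _) _.
  - by move=> x /(ball_pointsP Af).
  - by move=> x /(ball_pointsP Xf).
  rewrite /p mulrCA ler_pM2l ?unit_ball_vol_gt0//.
  by rewrite -addrA rM.
apply: le_trans (density_in_ball_le bC c0 Cc s0 Df) _.
rewrite lee_fin ler_pdivrMr ?ball_vol_gt0//.
have -> : T * (unit_ball_vol R n * s ^+ n.+1) = (1 - eps + (eps + eta) / l ^+ n.+1) * p.
  by rewrite /T /p rE [((1 + l) * s) ^+ _]exprMn; ring.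
apply: le_trans (density_estimate L0 L1 pA pAX).
rewrite -mulrDl ler_wpM2r ?(ltW V0)//.
have -> : s + c = (1 + l)^-1 * (r + (1 + l) * c).
  by rewrite rE; field; exact: lt0r_neq0.
have rc0 : 0 < r + (1 + l) * c by rewrite addr_gt0// mulr_gt0.
rewrite ball_count_scale//.
apply: le_trans (ball_countU_shift rc0 u0 tu Af Xf Yf) _.
by rewrite -addrA lerD2r ball_count_mono// lerD2l /K lerDl ltW.
Qed.

End CoveringFromPacking.

(** * From coverings to packings *)

Section PackingFromCovering.
Context {R : realType} {n : nat}.
Implicit Types (C A B : set 'rV[R]_n.+1).

Local Notation E := (@euclidean_ball R n.+1).

(** Turns sums of indicators into lengths of duplicate-free lists, which [uniq_leq_size]
    compares. *)
Lemma sum_indic_size (T : Type) (I : choiceType) (F : {fset I}) (K : I -> set T) (x : T) :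
  \sum_(i : F) \1_(K (val i)) x = (size [seq i <- (F : seq I) | x \in K i])%:R :> R.
Proof.
rewrite -(big_seq_fsetE _ _ xpredT (fun i => \1_(K i) x)) size_filter.
elim: (enum_fset F) => [|i s IH]; first by rewrite big_nil.
by rewrite big_cons IH /= natrD indicE.
Qed.

Lemma ball_count_split A B r : locally_finite A -> locally_finite B -> locally_finite (A `\` B) ->
  ball_count A r <= ball_count B r + ball_count (A `\` B) r.
Proof.
move=> Af Bf ABf; rewrite -natrD ler_nat.
have -> : (#|` ball_points B r| + #|` ball_points (A `\` B) r|)%N =
    size ((ball_points B r : seq _) ++ ball_points (A `\` B) r) by rewrite size_cat.
apply: uniq_leq_size; first exact: fset_uniq.
move=> y /(ball_pointsP Af)[Ay yr]; rewrite mem_cat.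
have [By|By] := pselect (B y); first by rewrite mem_ball_points.
by rewrite (mem_ball_points ABf)// orbT.
Qed.

Section Multiplicity.
Variables (C A B : set 'rV[R]_n.+1) (l c r : R) (z : 'rV[R]_n.+1 -> 'rV[R]_n.+1).
Hypotheses (bC : convex_body C) (l0 : 0 < l) (c0 : 0 < c) (Cc : C `<=` E c) (r0 : 0 < r).
Hypotheses (Af : locally_finite A) (covA : \bigcup_(a in A) translate C a = setT) (BA : B `<=` A).

Lemma ball_vol_le_covering :
  unit_ball_vol R n * r ^+ n.+1 <= ball_count A (r + c) * fvol C.
Proof.
have := @volume_le R n unit (ball_points A (r + c)) (fun=> E r) (fun a => translate C (val a)).
rewrite big_const iter_addr_0 card_unit mulr1n fvol_euclidean_ball//.
have -> : \sum_(a : ball_points A (r + c)) fvol (translate C (val a)) =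
    ball_count A (r + c) * fvol C.
  by under eq_bigr do rewrite fvol_translate//; rewrite sumr_const -cardfE mulr_natl.
apply=> [_|a|x]; first exact: euclidean_ball_convex_body.
  by have [] := translate_convex_body (val a) bC.
rewrite big_const iter_addr_0 card_unit mulr1n.
have [/interior_subset xr|xr] := pselect ((E r)° x); last by rewrite indicE memNset// sumr_ge0.
have : (\bigcup_(a in A) translate C a) x by rewrite covA.
move=> [a Aa xa].
have ar : a \in ball_points A (r + c).
  by apply: mem_ball_points => //; apply: (translate_meet_ball c0 Cc r0); exists x.
rewrite (bigD1 [` ar]%fset)//= [X in _ <= X + _]indicE mem_set//.
by rewrite (le_trans (_ : _ <= 1))// ?lerDl ?sumr_ge0// indicE lern1 leq_b1.
Qed.

Hypothesis zP : forall a, A a -> ~ B a -> homothet l (z a) C `<=` translate C a /\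
  exists2 b, B b & homothet l (z a) C `<=` translate C b.

(* A point lying in [k > 0] of the sets [z a + l C] lies in the [k] translates [C + a]
   and, since these meet the translates indexed by [B], in at least one more. *)
Lemma multiplicity_volume :
  unit_ball_vol R n * (r + 2 * c) ^+ n.+1 +
    ball_count (A `\` B) (r + c) * (l ^+ n.+1 * fvol C) <=
  ball_count A (r + 3 * c) * fvol C.
Proof.
have rc0 : 0 < r + c by rewrite addr_gt0.
have r2c0 : 0 < r + 2 * c by rewrite addr_gt0// mulr_gt0.
have ABf : locally_finite (A `\` B).
  by move=> s; apply: sub_finite_set (Af s) => x [[Ax _] xs].
(* Small copies indexed within [r + c] stay in the ball of radius [r + 2 * c], and translates
   meeting that ball are centred within [r + 3 * c]. *)
pose F := ball_points (A `\` B) (r + c); pose G := ball_points A (r + 3 * c).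
pose K (i : unit + F) := match i with
  | inl _ => E (r + 2 * c) | inr a => homothet l (z (val a)) C end.
have := @volume_le R n (unit + F)%type G K (fun a => translate C (val a)).
rewrite big_sumType/= big_const iter_addr_0 card_unit mulr1n fvol_euclidean_ball//.
have -> : \sum_(a : G) fvol (translate C (val a)) = ball_count A (r + 3 * c) * fvol C.
  by under eq_bigr do rewrite fvol_translate//; rewrite sumr_const -cardfE [RHS]mulr_natl.
have -> : \sum_(a : F) fvol (homothet l (z (val a)) C) =
    ball_count (A `\` B) (r + c) * (l ^+ n.+1 * fvol C).
  under eq_bigr do rewrite fvol_homothet ?gt_eqF// gtr0_norm//.
  by rewrite sumr_const -cardfE mulr_natl.
apply=> [[_|a]|a|x] /=.
- exact: euclidean_ball_convex_body.
- by apply: homothet_convex_body; rewrite ?gt_eqF.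
- by have [] := translate_convex_body (val a) bC.
rewrite big_sumType/= big_const iter_addr_0 card_unit mulr1n.
have sub2 a : E (r + c) a -> translate C a `<=` E (r + 2 * c).
  by move=> ar; rewrite mulr_natl mulr2n addrA; exact: translate_sub_ball.
have [xr|xr] := pselect (E (r + 2 * c) x); last first.
  rewrite indicE memNset ?add0r; last by move/interior_subset.
  rewrite big1 ?sumr_ge0// => a _; rewrite indicE memNset// => /interior_subset xa.
  have [[Aa Ba] ar] := ball_pointsP ABf (valP a).
  by apply: xr; apply: sub2 ar _ _; have [+ _] := zP Aa Ba; exact.
apply: (@le_trans _ _ (1 + \sum_(a : F) \1_(homothet l (z (val a)) C) x)).
  apply: lerD; first by rewrite indicE lern1 leq_b1.
  apply: ler_sum => a _; rewrite !indicE ler_nat.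
  have [/interior_subset xa|xa] := pselect ((homothet l (z (val a)) C)° x).
    by rewrite [X in (_ <= nat_of_bool X)%N]mem_set// leq_b1.
  by rewrite memNset.
rewrite (sum_indic_size _ (fun a => homothet l (z a) C)) (sum_indic_size _ (translate C)).
rewrite nat1r ler_nat.
set S := [seq a <- (F : seq _) | _].
have SP a : a \in S -> [/\ A a, ~ B a & homothet l (z a) C x].
  by rewrite mem_filter => /andP[/set_mem xa /(ball_pointsP ABf)[[]]].
have inG a : A a -> translate C a x -> a \in [seq a <- (G : seq _) | x \in translate C a].
  move=> Aa xa; rewrite mem_filter mem_set//=; apply: mem_ball_points => //.
  have -> : r + 3 * c = r + 2 * c + c by ring.
  by apply: (translate_meet_ball c0 Cc r2c0); exists x.
(* The additional translate: any one containing [x] if [S] is empty, otherwise one indexed by [B]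
   that contains the copy of the first point of [S]. It is outside [S] since [S] avoids [B]. *)
have [b [Ab xb bS]] : exists b, [/\ A b, translate C b x & b \notin S].
  case: S SP => [|a0 S] SP.
    have : (\bigcup_(a in A) translate C a) x by rewrite covA.
    by move=> [a Aa xa]; exists a.
  have [Aa Ba xa] := SP a0 (mem_head _ _).
  have [_ [b Bb zb]] := zP Aa Ba; exists b; split; [exact: BA|exact: zb|].
  by apply/negP => /SP[].
rewrite -[(size S).+1]/(size (b :: S)); apply: uniq_leq_size.
  by rewrite /= bS filter_uniq// fset_uniq.
move=> a; rewrite inE => /orP[/eqP->|/SP[Aa Ba xa]]; first exact: inG.
by apply: inG => //; have [+ _] := zP Aa Ba; exact.
Qed.

End Multiplicity.

(** Here [p] and [q] are ball volumes at an inner and an outer radius, and [NB], [Nr] count [B] and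
    the rest of [A]. Since [e < 1], [(1 + e) (1 + eta) <= 1 + e + 2 eta], so the small copies have
    total volume at most [(e + 2 eta) p]. *)
Lemma count_estimate (p q V L e eta NA NA3 NB Nr : R) : 0 < L -> 0 < p -> 0 < e -> e < 1 ->
  0 < eta -> 0 <= V ->
  q <= (1 + eta) * p -> NA3 * V <= (1 + e) * q -> p + Nr * (L * V) <= NA3 * V ->
  p <= NA * V -> NA <= NB + Nr -> (1 - (e + 2 * eta) / L) * p <= NB * V.
Proof.
move=> L0 p0 e0 e1 eta0 V0 qp h1 h2 h3 h4.
have h5 : NA * V <= (NB + Nr) * V by rewrite ler_wpM2r.
rewrite -(ler_pM2r L0).
have -> : (1 - (e + 2 * eta) / L) * p * L = p * L - (e + 2 * eta) * p.
  by field; rewrite gt_eqF.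
have h6 : (1 + e) * q <= (1 + e) * ((1 + eta) * p) by rewrite ler_wpM2l// addr_ge0// ltW.
have h7 : (1 + e) * ((1 + eta) * p) <= p + (e + 2 * eta) * p.
  have : 0 <= (1 - e) * eta * p by rewrite !mulr_ge0 ?subr_ge0 ?ltW.
  lra.
have h8 : p * L <= (NB + Nr) * V * L by rewrite ler_pM2r//; lra.
lra.
Qed.

Lemma packing_density_gt C (l eps : R) : convex_body C -> 0 < l < 1 -> 0 < eps -> eps < l ^+ n.+1 ->
  (covering_density C < (1 + eps)%:E)%E ->
  (((1 - l) ^+ n.+1 * (1 - eps / l ^+ n.+1))%:E < packing_density C)%E.
Proof.
move=> bC /andP[l0 l1] eps0 epsL /ereal_inf_lt[_ [A [[Ainf Adisc] covA] <-] Aeps].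
have L0 : 0 < l ^+ n.+1 by rewrite exprn_gt0.
have L1 : l ^+ n.+1 <= 1 by rewrite exprn_ile1// ltW.
have mu0 : 0 < 1 - l by rewrite subr_gt0.
set mu := 1 - l in mu0 *.
(* An [e] strictly below [eps] leaves room for error terms. If the density is at least
   [1 + eps / 2], then [1 + e] is the midpoint between it and [1 + eps]. *)
have [e [e0 ee Ae]] : exists e, [/\ 0 < e, e < eps & (lower_density C A < (1 + e)%:E)%E].
  have [lt|] := ltP (lower_density C A) (1 + eps / 2)%:E.
    by exists (eps / 2); split=> //; lra.
  case: (lower_density C A) Aeps => // x; rewrite lte_fin lee_fin => xe ex.
  by exists ((x - 1 + eps) / 2); rewrite lte_fin; split; lra.
have [cC /convex_setP vC _] := bC; have [c c0 Cc] := compact_sub_ball cC.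
have V0 := fvol_gt0 bC; set V := fvol C in V0.
have large M : exists s, [/\ M < s, c < s & ((\esum_(a in A) vol (translate C a `&` E s) <
    ((1 + e) * (unit_ball_vol R n * s ^+ n.+1))%:E)%E)].
  have [s] := limf_einf_pinfty_lt (Num.max M c) Ae.
  rewrite gt_max => /andP[Ms cs]; have s0 := lt_trans c0 cs.
  by rewrite density_in_ballE// lte_pdivrMr ?ball_vol_gt0// -EFinM => As; exists s.
(* The translates of finitely many points of [A] in a ball lie in a larger ball of bounded density,
   which limits their number. *)
have Af : locally_finite A.
  move=> r; have [s [rs cs As]] := large (`|r| + 1 + c).
  have s0 := lt_trans c0 cs.
  apply: (finite_set_card_bound V0 (B := (1 + e) * (unit_ball_vol R n * s ^+ n.+1))) => F FA.
  rewrite -lee_fin; apply: ltW; apply: le_lt_trans As.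
  apply: (esum_card_le_density bC) => a aF; have [Aa ar] := FA a aF.
  split=> //; apply: subset_trans (euclidean_ball_mono (ltW rs)).
  apply: (translate_sub_ball c0 Cc); first by rewrite ltr_wpDl.
  by apply: euclidean_ball_mono ar; rewrite (le_trans (ler_norm _))// lerDl.
(* The condition is stated after rescaling by [mu^-1], where the bodies [mu C + a] become translates
   of [C] itself. *)
have [B [BA Bdisj Bmax]] := maximal_pairwise A (fun a b : 'rV[R]_n.+1 =>
  (translate C (mu^-1 *: a))° `&` (translate C (mu^-1 *: b))° = set0).
(* Convexity places [mu x + l C] in [C], as [mu = 1 - l]. *)
have subC a x : C x -> homothet l (a + mu *: x) C `<=` translate C a.
  move=> Cx _ [y Cy <-]; exists (l *: y + (1 - l) *: x); last by rewrite addrC -addrA [mu *: x + _]addrC.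
  by apply: vC => //; rewrite !ltW.
have /choice[z zP] : forall a, exists z, A a -> ~ B a -> homothet l z C `<=` translate C a /\
    exists2 b, B b & homothet l z C `<=` translate C b.
  move=> a; have [Aa|] := pselect (A a); last by exists 0.
  have [//|[b Bb bad]] := Bmax a Aa; first by exists 0.
  have [x [/interior_subset[x1 Cx1 x1E] /interior_subset[x2 Cx2 x2E]]] :
      (translate C (mu^-1 *: a))° `&` (translate C (mu^-1 *: b))° !=set0.
    by apply/set0P/eqP => ab0; apply: bad; rewrite setIC.
  have E1 : mu *: x = a + mu *: x1 by rewrite -x1E scalerDr scalerA divff ?gt_eqF// scale1r addrC.
  have E2 : mu *: x = b + mu *: x2 by rewrite -x2E scalerDr scalerA divff ?gt_eqF// scale1r addrC.
  (* A common point of [a + mu C] and [b + mu C], so [subC] applies to both. *)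
  exists (mu *: x) => _ _; split; first by rewrite E1; exact: subC.
  by exists b => //; rewrite E2; exact: subC.
have Bf : locally_finite B by move=> s; apply: sub_finite_set (Af s) => x [/BA].
have ABf : locally_finite (A `\` B) by move=> s; apply: sub_finite_set (Af s) => x [[Ax _] xs].
have Binf : infinite_set B.
  (* Maximality puts every point of [A] within bounded distance of [B], so a finite [B] would make
     [A] bounded and hence finite. *)
  move=> Bfin; apply: Ainf.
  have [r r0 Br] := compact_sub_ball (finite_compact Bfin).
  apply: sub_finite_set (Af (r + c + c)) => a Aa; split=> //.
  have rc0 : 0 < r + c by rewrite addr_gt0.
  have [Ba|Ba] := pselect (B a).
    by apply: euclidean_ball_mono (Br _ Ba); rewrite -addrA lerDl addr_ge0// ltW.
  have [za [b Bb zb]] := zP a Aa Ba.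
  have [_ _ [x0 /interior_subset Cx0]] := bC.
  have x0z : homothet l (z a) C (z a + l *: x0) by exists x0.
  apply: (translate_meet_ball c0 Cc rc0); exists (z a + l *: x0); split; first exact: za.
  by apply: (translate_sub_ball c0 Cc r0 (Br _ Bb)); exact: zb.
have imu0 : 0 < mu^-1 by rewrite invr_gt0.
have [Df Ddisc] := scaled_arrangement imu0 Binf Bf.
set D := [set _ | _ in B] in Df Ddisc.
have packD : packing C D.
  split=> // _ _ [a Ba <-] [b Bb <-] ab; apply: Bdisj => // abE.
  by apply: ab; rewrite abE.
(* Thus [eps = e + 4 * eta]: [2 * eta] enters [kappa], and the rest pays for the factor [1 + eta]
   between the ball volumes. *)
pose eta := (eps - e) / 4.
have eta0 : 0 < eta by rewrite divr_gt0// subr_gt0.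
pose kappa := 1 - (e + 2 * eta) / l ^+ n.+1.
have kappaE : (1 + eta) * (1 - eps / l ^+ n.+1) < kappa.
  rewrite -(ltr_pM2r L0).
  have -> : kappa * l ^+ n.+1 = l ^+ n.+1 - (e + 2 * eta) by rewrite /kappa; field; rewrite gt_eqF.
  have -> : (1 + eta) * (1 - eps / l ^+ n.+1) * l ^+ n.+1 = (1 + eta) * (l ^+ n.+1 - eps).
    by field; rewrite gt_eqF.
  have : eps = e + 4 * eta by rewrite /eta; lra.
  have : eta * l ^+ n.+1 <= eta by rewrite ler_piMr// ltW.
  have : 0 < eta * eps by rewrite mulr_gt0.
  lra.
have kappa0 : 0 < kappa.
  apply: lt_trans kappaE; apply: mulr_gt0; first by rewrite addr_gt0.
  by rewrite subr_gt0 ltr_pdivrMr// mul1r.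
pose T := mu ^+ n.+1 * (kappa / (1 + eta)).
apply: (@lt_le_trans _ _ T%:E).
  by rewrite lte_fin ltr_pM2l ?exprn_gt0// ltr_pdivlMr ?addr_gt0// mulrC.
apply: (@le_trans _ _ (upper_density C D)); last by apply: ereal_sup_ubound; exists D.
have c4 : 0 <= 4 * c by rewrite mulr_ge0// ltW.
have [M M0 rM] := @expr_shift_le R n _ _ c4 eta0.
apply: limf_esup_pinfty_ge => S.
have [r [Mr cr Ar]] := large (Num.max (mu * `|S|) M + 4 * c).
(* The density bound is known at [r]; counting is done around [rho], so that translates centred
   within [rho + 3 * c] remain in the ball of radius [r]. *)
pose rho := r - 4 * c.
have [Srho Mrho] : mu * `|S| < rho /\ M < rho.
  by move: Mr; rewrite -ltrBrDr gt_max => /andP[].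
have rho0 := lt_trans M0 Mrho.
have r0 := lt_trans c0 cr.
have rE : r = rho + 4 * c by rewrite /rho subrK.
(* Chosen so that the points of [D] within [s - c] correspond to those of [B] within [rho + c];
   moreover [mu s <= r]. *)
pose s := mu^-1 * (rho + c) + c.
have rc0 : 0 < rho + c by rewrite addr_gt0.
have cs : c < s by rewrite ltrDr mulr_gt0.
have s0 := lt_trans c0 cs.
exists s.
  apply: (le_lt_trans (ler_norm S)); rewrite -(ltr_pM2l mu0) (lt_trans Srho)//.
  rewrite /s mulrDr mulrA divff ?gt_eqF// mul1r -addrA ltrDl addr_gt0// mulr_gt0//.
apply: le_trans (density_in_ball_ge bC c0 Cc s0 Df cs).
have -> : s - c = mu^-1 * (rho + c) by rewrite /s addrK.
rewrite ball_count_scale// lee_fin ler_pdivlMr ?ball_vol_gt0//.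
pose p := unit_ball_vol R n * rho ^+ n.+1.
have p0 : 0 < p by exact: ball_vol_gt0.
have beta0 := @unit_ball_vol_gt0 R n.
have qp : unit_ball_vol R n * r ^+ n.+1 <= (1 + eta) * p.
  by rewrite /p mulrCA ler_pM2l// rE rM.
have h1 : ball_count A (rho + 3 * c) * V <= (1 + e) * (unit_ball_vol R n * r ^+ n.+1).
  rewrite -lee_fin; apply: ltW; apply: le_lt_trans Ar.
  apply: (esum_card_le_density bC) => a /(ball_pointsP Af)[Aa ar]; split=> //.
  have -> : r = rho + 3 * c + c by rewrite rE; ring.
  by apply: (translate_sub_ball c0 Cc) => //; rewrite addr_gt0// mulr_gt0.
have h2 : p + ball_count (A `\` B) (rho + c) * (l ^+ n.+1 * V) <= ball_count A (rho + 3 * c) * V.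
  apply: le_trans (multiplicity_volume bC l0 c0 Cc rho0 Af covA BA zP).
  rewrite lerD2r ler_pM2l//.
  have rho2 : rho <= rho + 2 * c by rewrite lerDl mulr_ge0// ltW.
  by rewrite lerXn2r// nnegrE ?(le_trans _ rho2) ?(ltW rho0).
have h3 := ball_vol_le_covering bC c0 Cc rho0 Af covA.
have h4 := ball_count_split (rho + c) Af Bf ABf.
have e1 : e < 1 by apply: lt_trans ee (lt_le_trans epsL L1).
have := count_estimate L0 p0 e0 e1 eta0 (ltW V0) qp h1 h2 h3 h4.
apply: le_trans; rewrite -/kappa.
have ss : mu ^+ n.+1 * (unit_ball_vol R n * s ^+ n.+1) <= (1 + eta) * p.
  apply: le_trans qp; rewrite mulrCA ler_pM2l// -exprMn.
  rewrite lerXn2r ?nnegrE ?mulr_ge0 ?(ltW mu0) ?(ltW s0) ?(ltW r0)//.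
  rewrite /s mulrDr mulrA divff ?gt_eqF// mul1r rE.
  have : mu * c <= c by rewrite ler_piMl// ?ltW// gtrBl.
  lra.
have -> : kappa * p = kappa / (1 + eta) * ((1 + eta) * p).
  by rewrite [RHS]mulrA divfK// gt_eqF// addr_gt0.
rewrite /T [mu ^+ _ * _]mulrC -[leLHS]mulrA ler_wpM2l// divr_ge0 ?(ltW kappa0)//.
by rewrite addr_ge0// ltW.
Qed.

End PackingFromCovering.

(** * Reflection of a convex body *)

Section Reflection.
Context {R : realType} {n : nat}.
Implicit Types (C K : set 'rV[R]_n.+1).

Lemma convex_sum K m (mu : 'I_m -> R) (w : 'I_m -> 'rV[R]_n.+1) :
  convex_set (K : set (convex_lmodType 'rV[R]_n.+1)) ->
  (forall i, 0 <= mu i) -> \sum_i mu i = 1 -> (forall i, K (w i)) ->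
  K (\sum_i mu i *: w i).
Proof.
move=> /convex_setP cK; elim: m mu w => [|m IH] mu w mu0 mu1 Kw.
  by move/eqP: mu1; rewrite big_ord0 eq_sym oner_eq0.
rewrite big_ord_recl; rewrite big_ord_recl in mu1.
have s0 : 0 <= \sum_(i < m) mu (lift ord0 i) by apply: sumr_ge0.
have [s1|s1] := eqVneq (\sum_(i < m) mu (lift ord0 i)) 0.
  rewrite s1 addr0 in mu1; rewrite mu1 scale1r big1 ?addr0// => i _.
  have /(_ i isT) := psumr_eq0P (fun i _ => mu0 (lift ord0 i)) s1.
  by move=> ->; rewrite scale0r.
have sE : \sum_(i < m) mu (lift ord0 i) = 1 - mu ord0 by rewrite -mu1 addrAC subrr add0r.
rewrite sE in s0 s1.
have -> : \sum_(i < m) mu (lift ord0 i) *: w (lift ord0 i) =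
    (1 - mu ord0) *: \sum_(i < m) (mu (lift ord0 i) / (1 - mu ord0)) *: w (lift ord0 i).
  rewrite scaler_sumr; apply: eq_bigr => i _.
  by rewrite scalerA mulrC divfK.
apply: cK => //; last by rewrite mu0 -subr_ge0.
apply: IH => //; first by move=> i; rewrite divr_ge0.
by rewrite -mulr_suml sE divff.
Qed.

(** Homogeneous coordinates of the vertices: the determinant is [n.+1] factorial times the signed
    volume of the simplex, and solving against this matrix gives barycentric coordinates. *)
Definition simplex_mx (w : 'I_n.+2 -> 'rV[R]_n.+1) : 'M[R]_(1 + n.+1) :=
  \matrix_i row_mx 1 (w i).

Lemma simplex_mxEl w i : simplex_mx w i (lshift _ ord0) = 1.
Proof. by rewrite mxE row_mxEl mxE. Qed.

Lemma simplex_mxEr w i j : simplex_mx w i (rshift 1 j) = w i ord0 j.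
Proof. by rewrite mxE row_mxEr. Qed.

(** Cramer's rule: a barycentric coordinate is a ratio of signed simplex volumes. *)
Lemma simplex_det_replace (w : 'I_n.+2 -> 'rV[R]_n.+1) (x : 'rV[R]_n.+1) i :
  simplex_mx w \in unitmx ->
  (row_mx 1 x *m invmx (simplex_mx w)) ord0 i * \det (simplex_mx w) =
  \det (simplex_mx (fun j => if j == i then x else w j)).
Proof.
move=> wu; rewrite [RHS](expand_det_row _ i) /invmx wu -scalemxAr mxE mulrAC mulVf ?mul1r; last first.
  by rewrite -unitfE -unitmxE.
rewrite mxE; apply: eq_bigr => j _; rewrite !mxE eqxx; congr (_ * _).
rewrite /cofactor; congr (_ * \det _); apply/matrixP => a b; rewrite !mxE.
by rewrite eq_sym (negbTE (neq_lift _ _)).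
Qed.

(** The vertices are [c] and [c] moved along each axis. A vector in the kernel is an affine function
    vanishing at all of them, hence zero. *)
Lemma simplex_nondegenerate C : C° !=set0 ->
  exists2 w : 'I_n.+2 -> 'rV[R]_n.+1, (forall i, C (w i)) & \det (simplex_mx w) != 0.
Proof.
move=> [c /interior_normP[e e0 ce]].
pose w (i : 'I_n.+2) : 'rV[R]_n.+1 :=
  if unlift ord0 i is Some j then c + (e / 2) *: delta_mx ord0 j else c.
have e20 : 0 < e / 2 by rewrite divr_gt0.
exists w => [i|].
  rewrite /w; case: unliftP => [j _|_]; last by apply: ce; rewrite subrr normr0.
  apply: ce; rewrite opprD addrA subrr sub0r normrN normrZ gtr0_norm//.
  apply: (@le_lt_trans _ _ (e / 2 * 1)); last by lra.
  rewrite ler_wpM2l ?(ltW e20)//; apply: norm_le_coord => // k; rewrite mxE.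
  by case: (_ && _); rewrite ?normr1 ?normr0.
rewrite -det_tr; apply/det0P => -[u u0 uw].
have uE i : u ord0 (lshift _ ord0) + \sum_j u ord0 (rshift 1 j) * w i ord0 j = 0.
  have : (u *m (simplex_mx w)^T) ord0 i = 0 by rewrite uw mxE.
  rewrite mxE big_split_ord/= big_ord1 mxE simplex_mxEl mulr1 => ui.
  rewrite -[RHS]ui; congr (_ + _).
  by apply: eq_bigr => j _; rewrite mxE simplex_mxEr.
have uj j : u ord0 (rshift 1 j) = 0.
  have := uE (lift ord0 j); have := uE ord0; rewrite /w unlift_none liftK.
  move=> u1; under eq_bigr do rewrite mxE mulrDr.
  rewrite big_split/= addrA u1 add0r (bigD1 j)//= big1 => [|k kj].
    by rewrite !mxE !eqxx mulr1 addr0 => /eqP; rewrite mulf_eq0 (gt_eqF e20) orbF => /eqP.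
  by rewrite !mxE (negbTE kj) !mulr0.
have := uE ord0; rewrite big1 => [|j _]; last by rewrite uj mul0r.
rewrite addr0 => ul; move/negP: u0; apply; apply/eqP/rowP => i; rewrite mxE.
by case: (split_ordP i) => k ->; rewrite ?uj// (ord1 k).
Qed.

Lemma coord_continuous_mx p q (i : 'I_p) (j : 'I_q) :
  continuous (fun M : 'M['rV[R]_n.+1]_(p, q) => M i j).
Proof.
move=> /= M s /= /(nbhs_ballP (M i j)) [e e0 es].
by apply/nbhs_ballP; exists e => //= N [_ MN]; exact/es/MN.
Qed.

Lemma simplex_det_continuous :
  continuous (fun W : 'rV['rV[R]_n.+1]_n.+2 => \det (simplex_mx (W ord0))).
Proof.
have entry (i : 'I_n.+2) (j : 'I_(1 + n.+1)) :
    continuous (fun W : 'rV['rV[R]_n.+1]_n.+2 => simplex_mx (W ord0) i j).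
  case: (split_ordP j) => k ->.
    have -> : (fun W : 'rV['rV[R]_n.+1]_n.+2 => simplex_mx (W ord0) i (lshift _ k)) = cst 1.
      by apply/funext => W; rewrite (ord1 k) simplex_mxEl.
    exact: cst_continuous.
  have -> : (fun W : 'rV['rV[R]_n.+1]_n.+2 => simplex_mx (W ord0) i (rshift 1 k)) =
      (fun W => W ord0 i ord0 k) by apply/funext => W; rewrite simplex_mxEr.
  move=> W; apply: (@continuous_comp _ _ _ (fun W : 'rV['rV[R]_n.+1]_n.+2 => W ord0 i)
    (fun x : 'rV[R]_n.+1 => x ord0 k)); first exact: coord_continuous_mx.
  exact: coord_continuous.
have prodc (s : {perm 'I_n.+2}) (r : seq 'I_n.+2) :
    continuous (fun W : 'rV['rV[R]_n.+1]_n.+2 => \prod_(i <- r) simplex_mx (W ord0) i (s i)).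
  elim: r => [|i r IH]; first by under eq_fun do rewrite big_nil; exact: cst_continuous.
  under eq_fun do rewrite big_cons.
  move=> W; apply: (@continuousM _ _ (fun W : 'rV['rV[R]_n.+1]_n.+2 =>
    simplex_mx (W ord0) i (s i))); [exact: entry|exact: IH].
rewrite /determinant; elim: (index_enum _) => [|s r IH].
  by under eq_fun do rewrite big_nil; exact: cst_continuous.
under eq_fun do rewrite big_cons.
move=> W; apply: (@continuousD _ _ _ (fun W : 'rV['rV[R]_n.+1]_n.+2 =>
  (-1) ^+ s * \prod_i simplex_mx (W ord0) i (s i))); last exact: IH.
apply: (@continuousM _ _ (fun=> (-1) ^+ s)); [exact: cst_continuous|exact: prodc].
Qed.

(* Take a simplex of maximal volume with vertices [w i] in [C]: the barycentric coordinates
   [lam] of a point of [C] are at most 1, so the weights [(1 - lam i) / d] are nonnegative. *)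
Lemma convex_body_reflection C : convex_body C ->
  exists v, forall x, C x -> exists2 y, C y & - x = n.+1%:R *: y + v.
Proof.
move=> [cC vC iC].
have cW : compact [set W : 'rV['rV[R]_n.+1]_n.+2 | forall i, C (W ord0 i)].
  by refine (@rV_compact _ _ (fun=> C) _).
have [w0 w0C w0det] := simplex_nondegenerate iC.
have W0 : [set W : 'rV['rV[R]_n.+1]_n.+2 | forall i, C (W ord0 i)] !=set0.
  by exists (\row_i w0 i) => i; rewrite mxE.
have [W /set_mem WC Wmax] : exists2 W, W \in [set W : 'rV['rV[R]_n.+1]_n.+2 | forall i, C (W ord0 i)] &
    forall W', W' \in [set W : 'rV['rV[R]_n.+1]_n.+2 | forall i, C (W ord0 i)] ->
      `|\det (simplex_mx (W' ord0))| <= `|\det (simplex_mx (W ord0))|.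
  apply: (@compact_EVT_max _ _ (fun W : 'rV['rV[R]_n.+1]_n.+2 => `|\det (simplex_mx (W ord0))|)) => //.
  apply: continuous_subspaceT => W.
  apply: (@continuous_comp _ _ _ (fun W : 'rV['rV[R]_n.+1]_n.+2 => \det (simplex_mx (W ord0)))
    (fun x : R => `|x|)); first exact: simplex_det_continuous.
  exact: norm_continuous.
set w := W ord0 in WC Wmax.
have wmax (w' : 'I_n.+2 -> 'rV[R]_n.+1) : (forall i, C (w' i)) ->
    `|\det (simplex_mx w')| <= `|\det (simplex_mx w)|.
  move=> w'C; have -> : simplex_mx w' = simplex_mx ((\row_i w' i) ord0).
    by apply/matrixP => i j; rewrite !mxE.
  by apply: Wmax; apply: mem_set => i; rewrite mxE.
have wdet : 0 < `|\det (simplex_mx w)|.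
  by apply: lt_le_trans (wmax _ w0C); rewrite normr_gt0.
have wu : simplex_mx w \in unitmx by rewrite unitmxE unitfE -normr_gt0.
exists (- \sum_i w i) => x Cx.
pose lam (i : 'I_n.+2) := (row_mx 1 x *m invmx (simplex_mx w)) ord0 i.
have lamE : (row_mx 1 x *m invmx (simplex_mx w)) *m simplex_mx w = row_mx 1 x by rewrite mulmxKV.
have lam1 : \sum_i lam i = 1.
  have := congr1 (fun A : 'rV_(1 + n.+1) => A ord0 (lshift _ ord0)) lamE.
  rewrite row_mxEl [RHS]mxE mxE eqxx => lamE1; rewrite -[RHS]lamE1.
  by apply: eq_bigr => i _; rewrite simplex_mxEl mulr1.
have lamx : \sum_i lam i *: w i = x.
  apply/rowP => j; have := congr1 (fun A : 'rV_(1 + n.+1) => A ord0 (rshift 1 j)) lamE.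
  rewrite row_mxEr mxE summxE => <-; apply: eq_bigr => i _.
  by rewrite simplex_mxEr mxE.
(* The absolute value of [lam i] is the volume ratio after replacing the vertex [w i] by the point
   [x] of [C], so maximality bounds it by 1. *)
have lam_le1 i : lam i <= 1.
  apply: le_trans (ler_norm _) _; rewrite -(ler_pM2r wdet) -normrM mul1r.
  rewrite simplex_det_replace//; apply: wmax => j.
  by case: ifP.
have d0 : n.+1%:R != 0 :> R by rewrite pnatr_eq0.
(* The weights sum to [(n.+2 - 1) / n.+1 = 1], and multiplication by [n.+1] leaves the sum of the
   [w i] minus [x]. *)
exists (\sum_i ((1 - lam i) / n.+1%:R) *: w i).
  apply: convex_sum => // [i|]; first by rewrite divr_ge0// subr_ge0.
  rewrite -mulr_suml sumrB lam1 sumr_const card_ord.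
  by have -> : n.+2%:R - 1 = n.+1%:R :> R; [rewrite -natr1 addrK|rewrite divff].
rewrite scaler_sumr -sumrB -lamx -sumrN; apply: eq_bigr => i _.
by rewrite scalerA mulrC divfK// scalerBl scale1r addrAC subrr add0r.
Qed.

End Reflection.

(** * Choice of parameters and conclusion *)

Lemma powR_root (R : realType) (eps : R) m : 0 <= eps -> (eps `^ (1 / m.+1%:R)) ^+ m.+1 = eps.
Proof.
by move=> eps0; rewrite -powR_mulrn ?powR_ge0// -powRrM div1r mulVf ?powRr1// pnatr_eq0.
Qed.

Theorem theorem1p2 (R : realType) (d : nat) (C : set 'rV[R]_d) :
  (2 <= d)%N -> convex_body C ->
  [/\ forall eps : R,
        (0 < eps <= 1 / d%:R ^+ d.+1) \/
        (0 < eps < 1 /\ centrally_symmetric C) ->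
        ((1 - eps)%:E < packing_density C)%E ->
        (covering_density C < ((1 + eps `^ (1 / d.+1%:R)) ^+ d.+1)%:E)%E,
      forall eps : R,
        1 / d%:R ^+ d.+1 < eps < 1 ->
        ~ centrally_symmetric C ->
        ((1 - eps)%:E < packing_density C)%E ->
        (covering_density C
           < ((1 + eps * d%:R ^+ d) * (1 + 1 / d%:R) ^+ d)%:E)%E
    & forall eps : R,
        0 < eps < 1 ->
        (covering_density C < (1 + eps)%:E)%E ->
        (((1 - eps `^ (1 / d.+1%:R)) ^+ d.+1)%:E < packing_density C)%E].
Proof.
case: d C => // n C _ bC.
have d0 : 0 < n.+1%:R :> R by rewrite ltr0n.
have d1 : 1 <= n.+1%:R :> R by rewrite ler1n.
have [v vP] := convex_body_reflection bC.
have lt1 (eps : R) : 0 < eps < 1 -> eps `^ (1 / n.+2%:R) < 1.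
  move=> /andP[eps0 eps1]; rewrite -(@ltr_pXn2r _ n.+2)// ?nnegrE ?powR_ge0//.
  by rewrite powR_root ?ltW// expr1n.
(* With [l = eps^(1 / (d + 1))] this reads [eps / l^d = l], so the general bounds become
   [(1 + l)^(d + 1)] and [(1 - l)^(d + 1)]. *)
have rootE (eps : R) : 0 < eps ->
    eps / (eps `^ (1 / n.+2%:R)) ^+ n.+1 = eps `^ (1 / n.+2%:R).
  move=> eps0; rewrite -{1}(powR_root n.+1 (ltW eps0)) exprS mulfK//.
  by rewrite expf_neq0// gt_eqF// powR_gt0.
split=> [eps epsP|eps /andP[eps1 _] _|eps eps01] den.
- have eps0 : 0 < eps by case: epsP => [/andP[]|[/andP[]]].
  have l0 := powR_gt0 (1 / n.+2%:R) eps0.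
  rewrite exprSr -{2}(rootE _ eps0).
  case: epsP => [/andP[_ epsd]|[eps1 [u Cu]]].
    (* The bound on [eps] amounts to [l <= 1 / d], that is [l k <= 1] for [k = d]. *)
    have ld : eps `^ (1 / n.+2%:R) <= n.+1%:R^-1.
      rewrite -(@ler_pXn2r _ n.+2)// ?nnegrE ?powR_ge0 ?invr_ge0//.
      by rewrite powR_root ?(ltW eps0)// exprVn -div1r.
    apply: (covering_density_lt bC (ltW d0) vP) => //.
      by rewrite (le_trans ld)// invf_le1.
    by rewrite -ler_pdivlMr// [leRHS]div1r.
  (* From [C = u - C], each [- x] with [x] in [C] is [y - u] with [y] in [C], so [k = 1] and
     [v = - u]. *)
  apply: (@covering_density_lt _ _ C 1 _ _ (- u)) => //.
  + by move=> x; rewrite {1}Cu => -[y Cy <-]; exists y; rewrite // scale1r opprB.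
  + by rewrite ltW// lt1.
  + by rewrite mulr1 ltW// lt1.
- have eps0 : 0 < eps by apply: le_lt_trans eps1; rewrite divr_ge0// exprn_ge0.
  (* Here [l = 1 / d], the largest value with [l k <= 1] for [k = d]. *)
  have -> : (1 + eps * n.+1%:R ^+ n.+1) * (1 + 1 / n.+1%:R) ^+ n.+1 =
      (1 + n.+1%:R^-1) ^+ n.+1 * (1 + eps / n.+1%:R^-1 ^+ n.+1).
    by rewrite [LHS]mulrC div1r exprVn invrK.
  apply: (covering_density_lt bC (ltW d0) vP _ _ _ eps0 den).
  + by rewrite invr_gt0.
  + by rewrite invf_le1.
  + by rewrite mulVf// gt_eqF.
- have /andP[eps0 eps1] := eps01.
  have l0 := powR_gt0 (1 / n.+2%:R) eps0.
  rewrite exprSr -{2}(rootE _ eps0); apply: packing_density_gt => //.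
    by rewrite l0 lt1.
  (* [eps = l^(d + 1) < l^d] because [l < 1]. *)
  by rewrite -{1}(powR_root n.+1 (ltW eps0)) exprS gtr_pMl ?exprn_gt0// lt1.
Qed.
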